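(* Assume: $f=F\circ G$ and $h$ are convex; every $F_i$ is $L_F$-smooth with $B_F$-bounded gradient and every $G_j$ is $L_G$-smooth with $B_G$-bounded Jacobian; $\|[\nabla G_j(x)]^\top\nabla F_i(G(x))-[\nabla G_j(y)]^\top\nabla F_i(G(y))\|\le L\|x-y\|$ for all $i\in[n_1]$, $j\in[n_2]$ and $x,y\in\mathbb R^{N_2}$. Let $x^*$ be a minimizer of $H=f+h$, $H^*=H(x^* )$, and suppose $H(x_0)-H^*\le D_H$ and $\|x_0-x^*\|^2\le D_x$ with $D_H,D_x>0$. Let $0<\varepsilon<D_H$, $\mu_0=D_H/D_x$, $T=\log_2(D_H/\varepsilon)$ (rounded up to an integer), and assume $L\ge\mu_0$. Then the algorithm NoCK with these $\mu_0,T$, using SoCK with Option II as subroutine, can produce a stochastic $\varepsilon$-solution $x_T$, i.e. $\mathbb E[H(x_T)-H^*]\le\varepsilon$, with overall complexity $$O\left((n_1+n_2)\log\frac{D_H}{\varepsilon}+\frac{D_x^{2.5}\sqrt L\cdot\max\{B_G^4L_F^2,\,B_F^2L_G^2,\,L^2\}}{\varepsilon^{2.5}}\right),$$ where the constant in $O(\cdot)$ is universal.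
   Context: Problem: $\min_{x\in\mathbb R^{N_2}}H(x)=f(x)+h(x)$ with $f=F\circ G$, $F=\frac1{n_1}\sum_{i=1}^{n_1}F_i$, $G=\frac1{n_2}\sum_{j=1}^{n_2}G_j$, where $F_i:\mathbb R^{N_1}\to\mathbb R$ and $G_j:\mathbb R^{N_2}\to\mathbb R^{N_1}$ are differentiable and $h:\mathbb R^{N_2}\to\mathbb R\cup\{+\infty\}$ is a proper closed convex function. $\nabla$ denotes the gradient of a scalar function and the Jacobian matrix of a vector-valued map; $\|\cdot\|$ is the Euclidean norm of vectors and the spectral norm of matrices; $[n]=\{1,\dots,n\}$. A differentiable map $\phi$ is $l$-smooth if $\|\nabla\phi(x)-\nabla\phi(x')\|\le l\|x-x'\|$ for all $x,x'$; it has $b$-bounded gradient/Jacobian if $\|\nabla\phi(x)\|\le b$ for all $x$. Algorithm NoCK. Input $x_0$, $\mu_0$, $T$. For $t=0,\dots,T-1$: let $H_t(x)=H(x)+\frac{\mu_t}2\|x-x_0\|^2$ with minimum value $H_t^*$; apply SoCK from starting point $x_t$ to $\min_xH_t(x)$, written as $f+h_t$ with $h_t=h+\frac{\mu_t}2\|\cdot-x_0\|^2$ (which is $\mu_t$-strongly convex), to find $x_{t+1}$ such that $\mathbb E[H_t(x_{t+1})-H_t^*\mid x_t]\le\frac14(H_t(x_t)-H_t^* )$; set $\mu_{t+1}=\mu_t/2$. Return $x_T$. Algorithm SoCK (Option II) for $\min f+h$ with $h$ $\mu$-strongly convex (in NoCK: $h:=h_t$, $\mu:=\mu_t$, starting point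 $x_t$). Parameters: $m=\lceil\frac12\sqrt{L/\mu}\rceil$, $\tau_1=\tau_2=\frac1{2m}$, $\theta=1+\frac1{12m}$, $\alpha=\frac1{3\tau_1L}$, $A=\frac{2160B_G^4L_F^2}{\mu^2}$, $B=\frac{2160B_F^2L_G^2}{\mu^2}$, $C=\frac{1080L^2}{\mu^2}$ (rounded up to the nearest positive integer), and a number $S$ of outer loops, which in NoCK is a sufficiently large universal constant. With starting point $x_0$ ($h(x_0)<\infty$), set $y_0=z_0=\widetilde x^0=x_0$. For $s=0,\dots,S-1$: compute $G(\widetilde x^s)$, $\nabla G(\widetilde x^s)$, $\nabla f(\widetilde x^s)$; for $j=0,\dots,m-1$, put $k=sm+j$ and (1) $x_{k+1}=\tau_1z_k+\tau_2\widetilde x^s+(1-\tau_1-\tau_2)y_k$; (2) draw multisets $\mathcal A_k,\mathcal B_k$ from $[n_2]$ and $\mathcal C_k$ from $[n_1]$, uniformly at random with replacement, with $|\mathcal A_k|=A$, $|\mathcal B_k|=B$, $|\mathcal C_k|=C$ (all draws mutually independent); (3) $\widehat G_k=\frac1A\sum_{i\in\mathcal A_k}(G_i(x_{k+1})-G_i(\widetilde x^s))+G(\widetilde x^s)$ and $\nabla\widehat G_k=\frac1B\sum_{i\in\mathcal B_k}(\nabla G_i(x_{k+1})-\nabla G_i(\widetilde x^s))+\nabla G(\widetilde x^s)$; (4) $\widetilde\nabla_{k+1}=\frac1C\sum_{i\in\mathcal C_k}\big([\nabla\widehat G_k]^\top\nabla F_i(\widehat G_k)-[\nabla G(\widetilde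 x^s)]^\top\nabla F_i(G(\widetilde x^s))\big)+\nabla f(\widetilde x^s)$; (5) $z_{k+1}=\arg\min_z\{\langle\widetilde\nabla_{k+1},z\rangle+\frac1{2\alpha}\|z-z_k\|^2+h(z)\}$; (6) $y_{k+1}=\arg\min_y\{\langle\widetilde\nabla_{k+1},y\rangle+\frac{3L}2\|y-x_{k+1}\|^2+h(y)\}$. After the inner loop, $\widetilde x^{s+1}=\big(\sum_{j=0}^{m-1}\theta^j\big)^{-1}\sum_{j=0}^{m-1}\theta^jy_{sm+j+1}$. Output $\widetilde x^S$. Overall complexity is the total, over all calls of SoCK, of the number of evaluations of $\nabla F_i$, $G_j$, $\nabla G_j$ and of the proximal mapping of $h_t$. In the complexity bound, $\log(\cdot)$ is read as $\max\{1,\log(\cdot)\}$. *)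

(* Defs.v *)
From HB Require Import structures.
From mathcomp Require Import all_boot all_order all_algebra.
From mathcomp Require Import all_classical all_reals all_analysis.

Set Implicit Arguments.
Unset Strict Implicit.
Unset Printing Implicit Defensive.

Import Order.TTheory GRing.Theory Num.Theory.
Import numFieldNormedType.Exports.

Local Open Scope classical_set_scope.
Local Open Scope ring_scope.

(* Vectors of R^n are row vectors 'rV[R]_n, the library's setting for
   Jacobians.  For a matrix A of size p x q, the product A v of the usual column
   convention is v *m A^T, and A^T u is u *m A. *)

Section Euclidean.
Context {R : realType}.

Definition dot n (u v : 'rV[R]_n) : R := \sum_i u 0 i * v 0 i.

(* The library's norm `|u| on 'rV[R]_n is the sup norm, not this one. *)
Definition enorm n (u : 'rV[R]_n) : R := Num.sqrt (dot u u).

(* Spectral norm: sup of the Euclidean norm of A v over the unit ball. *)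
Definition specnorm p q (A : 'M[R]_(p, q)) : R :=
  sup [set enorm (v *m A^T) | v in [set v : 'rV[R]_q | enorm v <= 1]].

Definition grad n (phi : 'rV[R]_n -> R) (x : 'rV[R]_n) : 'rV[R]_n :=
  \row_i 'D_(delta_mx 0 i) phi x.

(* 'J Phi x acts on row vectors from the right, so the usual Jacobian matrix
   (one row per component of Phi) is its transpose. *)
Definition Jac n p (Phi : 'rV[R]_n -> 'rV[R]_p) (x : 'rV[R]_n) : 'M[R]_(p, n) :=
  ('J Phi x)^T.

Definition smooth_fun n (l : R) (phi : 'rV[R]_n -> R) : Prop :=
  forall x x', enorm (grad phi x - grad phi x') <= l * enorm (x - x').

Definition bounded_grad n (b : R) (phi : 'rV[R]_n -> R) : Prop :=
  forall x, enorm (grad phi x) <= b.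

Definition smooth_map n p (l : R) (Phi : 'rV[R]_n -> 'rV[R]_p) : Prop :=
  forall x x', specnorm (Jac Phi x - Jac Phi x') <= l * enorm (x - x').

Definition bounded_Jac n p (b : R) (Phi : 'rV[R]_n -> 'rV[R]_p) : Prop :=
  forall x, specnorm (Jac Phi x) <= b.

Definition proper_fun n (h : 'rV[R]_n -> \bar R) : Prop :=
  (forall x, h x != -oo%E) /\ (exists x, h x != +oo%E).

(* Only meant for h without value -oo; at t = 0 or t = 1 this relies on
   the library convention 0 * +oo = 0. *)
Definition econvex n (h : 'rV[R]_n -> \bar R) : Prop :=
  forall (t : R) (x y : 'rV[R]_n), 0 <= t <= 1 ->
    (h (t *: x + (1 - t) *: y)%R <= t%:E * h x + (1 - t)%R%:E * h y)%E.

Definition proper_closed_convex n (h : 'rV[R]_n -> \bar R) : Prop :=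
  [/\ proper_fun h, lower_semicontinuous h & econvex h].

(* The minimizer when there is one (arbitrary otherwise). *)
Definition argmin n (phi : 'rV[R]_n -> \bar R) : 'rV[R]_n :=
  get [set z | forall u, (phi z <= phi u)%E].

End Euclidean.

Section UniformExpectation.
Context {R : realType} {Omega : finType}.
Local Open Scope ereal_scope.

(* Expectation under the uniform distribution on Omega. *)
Definition expect (X : Omega -> \bar R) : \bar R :=
  ((#|Omega|%:R : R)^-1)%R%:E * \sum_(w : Omega) X w.

(* E[X | Y] evaluated at w: average of X over the event Y = Y w. *)
Definition cond_expect (V : eqType) (X : Omega -> \bar R) (Y : Omega -> V)
    (w : Omega) : \bar R :=
  ((#|[set w' : Omega | Y w' == Y w]%SET|%:R : R)^-1)%R%:E *
  \sum_(w' : Omega | Y w' == Y w) X w'.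

End UniformExpectation.

Section SoCKConstants.
Context {R : realType}.

(* Ceiling of a nonnegative real, as a natural number. *)
Definition nceil (x : R) : nat := `|Num.ceil x|%N.

Definition pceil (x : R) : nat := maxn 1 (nceil x).

(* The constants of the problem. *)
Record constants := Constants
  { cL : R; cLF : R; cBF : R; cLG : R; cBG : R }.

Variables (c : constants) (mu : R).

Definition inner_len : nat := nceil (2^-1 * Num.sqrt (cL c / mu)).
Definition tau : R := (2 * inner_len%:R)^-1.
Definition theta : R := 1 + (12 * inner_len%:R)^-1.
Definition alpha : R := (3 * tau * cL c)^-1.
Definition sizeA : nat := pceil (2160 * cBG c ^+ 4 * cLF c ^+ 2 / mu ^+ 2).
Definition sizeB : nat := pceil (2160 * cBF c ^+ 2 * cLG c ^+ 2 / mu ^+ 2).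
Definition sizeC : nat := pceil (1080 * cL c ^+ 2 / mu ^+ 2).

End SoCKConstants.

Section Algorithms.
Context {R : realType} {n1 n2 N1 N2 : nat}.
Variables (F : 'I_n1 -> 'rV[R]_N1 -> R) (G : 'I_n2 -> 'rV[R]_N2 -> 'rV[R]_N1).

Definition Favg (u : 'rV[R]_N1) : R := n1%:R^-1 * \sum_i F i u.
Definition Gavg (x : 'rV[R]_N2) : 'rV[R]_N1 := n2%:R^-1 *: \sum_j G j x.
Definition fcomp (x : 'rV[R]_N2) : R := Favg (Gavg x).
Definition objective (h : 'rV[R]_N2 -> \bar R) (x : 'rV[R]_N2) : \bar R :=
  ((fcomp x)%:E + h x)%E.

(* Total number of evaluations of the gradients of F_i, of G_j, of the Jacobians
   of G_j and of the proximal mapping is accumulated in the field calls. *)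
Record state := State
  { st_y : 'rV[R]_N2; st_z : 'rV[R]_N2; calls : nat }.

Definition charge (k : nat) (st : state) : state :=
  State (st_y st) (st_z st) (calls st + k).

(* Samples of one inner iteration.  All sample spaces are products carrying the
   uniform distribution, so that all draws are uniform and independent. *)
Definition draws (A B C : nat) : finType :=
  ({ffun 'I_A -> 'I_n2} * {ffun 'I_B -> 'I_n2} * {ffun 'I_C -> 'I_n1})%type.

Section SoCK.
Variables (c : @constants R) (mu : R) (h : 'rV[R]_N2 -> \bar R).

Let m := inner_len c mu.
Let A := sizeA c mu.
Let B := sizeB c mu.
Let C := sizeC c mu.

Definition SoCK_step (xt : 'rV[R]_N2) (w : draws A B C) (st : state) : state :=
  let: (wA, wB, wC) := w in
  let y := st_y st in
  let z := st_z st in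
  let t := tau c mu in
  let x := t *: z + t *: xt + (1 - t - t) *: y in
  (* A + A evaluations of G_j *)
  let Ghat := A%:R^-1 *: (\sum_(i < A) (G (wA i) x - G (wA i) xt)) + Gavg xt in
  (* B + B evaluations of Jacobians of G_j *)
  let Jhat := B%:R^-1 *: (\sum_(i < B) (Jac (G (wB i)) x - Jac (G (wB i)) xt))
              + Jac Gavg xt in
  (* C + C evaluations of gradients of F_i *)
  let g := C%:R^-1 *: (\sum_(i < C) (grad (F (wC i)) Ghat *m Jhat
                          - grad (F (wC i)) (Gavg xt) *m Jac Gavg xt))
           + grad fcomp xt in
  (* two proximal evaluations *)
  let z' := argmin (fun u => ((dot g u
              + (2 * alpha c mu)^-1 * enorm (u - z) ^+ 2)%R%:E + h u)%E) in
  let y' := argmin (fun u => ((dot g u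
              + 3 * cL c / 2 * enorm (u - x) ^+ 2)%R%:E + h u)%E) in
  charge (A + A + (B + B) + (C + C) + 2) (State y' z' (calls st)).

(* The state after k inner iterations; ordinals are enumerated increasingly. *)
Definition inner_state (xt : 'rV[R]_N2) (w : {ffun 'I_m -> draws A B C})
    (st : state) (k : nat) : state :=
  foldl (fun s j => SoCK_step xt (w j) s) st (take k (enum 'I_m)).

(* One outer loop on (snapshot, state).  The initial charge is for G (n2
   evaluations), its Jacobian (n2) and the gradient of f (n1) at the snapshot. *)
Definition SoCK_outer (xst : 'rV[R]_N2 * state)
    (w : {ffun 'I_m -> draws A B C}) : 'rV[R]_N2 * state :=
  let: (xt, st) := xst in
  let run := inner_state xt w (charge (n2 + n2 + n1) st) in
  let th := theta c mu in
  ((\sum_(j < m) th ^+ j)^-1 *: (\sum_(j < m) th ^+ j *: st_y (run j.+1)),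
   run m).

Definition SoCK_space (S : nat) : finType :=
  {ffun 'I_S -> {ffun 'I_m -> draws A B C}}.

(* Output point and number of evaluations of S outer loops from x0. *)
Definition SoCK (S : nat) (x0 : 'rV[R]_N2) (w : SoCK_space S) :
    'rV[R]_N2 * nat :=
  let: (xt, st) :=
    foldl (fun xst s => SoCK_outer xst (w s)) (x0, State x0 x0 0) (enum 'I_S) in
  (xt, calls st).

End SoCK.

Section NoCK.
Variables (c : @constants R) (h : 'rV[R]_N2 -> \bar R) (S : nat).
Variables (x0 : 'rV[R]_N2) (mu0 : R) (T : nat).

Definition NoCK_mu (t : nat) : R := mu0 / 2 ^+ t.

Definition NoCK_h (t : nat) (x : 'rV[R]_N2) : \bar R :=
  (h x + (NoCK_mu t / 2 * enorm (x - x0) ^+ 2)%R%:E)%E.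

Definition NoCK_H (t : nat) : 'rV[R]_N2 -> \bar R := objective (NoCK_h t).

Definition NoCK_Hmin (t : nat) : \bar R := ereal_inf (range (NoCK_H t)).

(* Fresh samples for each of the T calls of SoCK. *)
Definition NoCK_space : finType :=
  {dffun forall t : 'I_T, SoCK_space c (NoCK_mu t) S}.

(* x_t, together with the number of evaluations made so far. *)
Definition NoCK_run (t : nat) (w : NoCK_space) : 'rV[R]_N2 * nat :=
  foldl (fun xk (i : 'I_T) =>
           let: (x, k) := xk in
           let: (x', k') := @SoCK c (NoCK_mu i) (NoCK_h i) S x (w i) in
           (x', k + k')%N)
        (x0, 0%N) (take t (enum 'I_T)).

Definition NoCK_iter (t : nat) (w : NoCK_space) : 'rV[R]_N2 := (NoCK_run t w).1.

Definition NoCK_complexity (w : NoCK_space) : nat := (NoCK_run T w).2.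

(* The decrease NoCK demands from each call of its subroutine. *)
Definition NoCK_requirement : Prop :=
  forall (t : nat) (w : NoCK_space), (t < T)%N ->
    (cond_expect (fun w' => NoCK_H t (NoCK_iter t.+1 w') - NoCK_Hmin t)
                 (NoCK_iter t) w
     <= 4^-1%R%:E * (NoCK_H t (NoCK_iter t w) - NoCK_Hmin t))%E.

End NoCK.

End Algorithms.

(* Main.v *)
(* Restarted regularization: round t adds mu_t/2 |x - x0|^2, so that SoCK works
   on a mu_t-strongly convex problem.  With R^2 = |x0 - xstar|^2, one has
   H_t^* <= H^* + mu_t R^2 / 2; hence if each call contracts the gap of H_t by a
   small factor, the gaps stay below (4/3) DH / 2^t, and strong convexity of H_t
   at the midpoint of x_T and xstar turns the last gap into the bound on H.

   SoCK is a variance-reduced accelerated (Katyusha type) method whose gradient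
   estimator is biased.  The mini-batch sizes make its mean squared error at most
   mu^2/180 |x - xt|^2.  The bias and the variance are then paid for by strong
   convexity: |x - xt|^2 is bounded by the distances of z, y and xt to the
   minimizer, that is, by the gaps over mu and by the proximal term.  Weighting
   the inner steps by theta^j gives an expected contraction by 12/13 of a
   Lyapunov function per outer loop, whatever the condition number. *)

Require Import Defs.
From HB Require Import structures.
From mathcomp Require Import all_boot all_order all_algebra.
From mathcomp Require Import all_classical all_reals all_analysis.
From mathcomp Require Import ring lra.

Set Implicit Arguments.
Unset Strict Implicit.
Unset Printing Implicit Defensive.

Import Order.TTheory GRing.Theory Num.Theory.
Import numFieldNormedType.Exports.
Local Open Scope classical_set_scope.
Local Open Scope ring_scope.

(** * Euclidean and spectral norms *)

(** The obstacle is the bias. An unbiased error [e] would make [dot e (xs - z)] average to zero,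
    since [z] does not depend on the current draw. Here this term survives and is split by Young's
    inequality with a weight proportional to [mu]. The mean squared error is therefore divided by
    [mu], which forces batches of order 1/mu^2 and, with mu about eps/Dx in the last rounds, the
    exponent 5/2 in the complexity.

    The contraction 1/4 required of each call is too weak for this argument to reach accuracy eps
    after exactly T rounds. The threshold on S is chosen so that every call contracts by 1/16, which
    closes the final estimate with equality.

    Sample spaces are finite, so expectations are finite averages. Independence enters either as an
    exchange of sums over a product or by resampling one coordinate of a family of draws. The second
    form also works on an event fixed by earlier draws, which is how the conditional expectation is
    treated. *)

Section EuclideanAlgebra.
Context {R : realType}.
Implicit Types (n p q : nat).

Lemma dotC n (u v : 'rV[R]_n) : dot u v = dot v u.
Proof. by apply: eq_bigr => i _; rewrite mulrC. Qed.

Lemma dotDl n (u v w : 'rV[R]_n) : dot (u + v) w = dot u w + dot v w.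
Proof. by rewrite /dot -big_split; apply: eq_bigr => i _; rewrite mxE mulrDl. Qed.

Lemma dotDr n (u v w : 'rV[R]_n) : dot w (u + v) = dot w u + dot w v.
Proof. by rewrite dotC dotDl !(dotC w). Qed.

Lemma dotZl n (a : R) (u v : 'rV[R]_n) : dot (a *: u) v = a * dot u v.
Proof. by rewrite /dot mulr_sumr; apply: eq_bigr => i _; rewrite mxE mulrA. Qed.

Lemma dotZr n (a : R) (u v : 'rV[R]_n) : dot u (a *: v) = a * dot u v.
Proof. by rewrite dotC dotZl dotC. Qed.

Lemma dotNl n (u v : 'rV[R]_n) : dot (- u) v = - dot u v.
Proof. by rewrite -scaleN1r dotZl mulN1r. Qed.

Lemma dotNr n (u v : 'rV[R]_n) : dot u (- v) = - dot u v.
Proof. by rewrite dotC dotNl dotC. Qed.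

Lemma dotBl n (u v w : 'rV[R]_n) : dot (u - v) w = dot u w - dot v w.
Proof. by rewrite dotDl dotNl. Qed.

Lemma dotBr n (u v w : 'rV[R]_n) : dot w (u - v) = dot w u - dot w v.
Proof. by rewrite dotDr dotNr. Qed.

Lemma dot0l n (u : 'rV[R]_n) : dot 0 u = 0.
Proof. by rewrite -(scale0r u) dotZl mul0r. Qed.

Lemma dot0r n (u : 'rV[R]_n) : dot u 0 = 0.
Proof. by rewrite dotC dot0l. Qed.

Lemma dot_suml n (I : Type) (r : seq I) (P : pred I) (f : I -> 'rV[R]_n) v :
  dot (\sum_(i <- r | P i) f i) v = \sum_(i <- r | P i) dot (f i) v.
Proof.
by elim/big_rec2: _ => [|i a b _ <-]; rewrite ?dot0l ?dotDl.
Qed.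

Lemma dot_sumr n (I : Type) (r : seq I) (P : pred I) (f : I -> 'rV[R]_n) v :
  dot v (\sum_(i <- r | P i) f i) = \sum_(i <- r | P i) dot v (f i).
Proof. by rewrite dotC dot_suml; apply: eq_bigr => i _; rewrite dotC. Qed.

Lemma dot_ge0 n (u : 'rV[R]_n) : 0 <= dot u u.
Proof. by apply: sumr_ge0 => i _; rewrite -expr2 sqr_ge0. Qed.

Lemma enorm_ge0 n (u : 'rV[R]_n) : 0 <= enorm u.
Proof. exact: sqrtr_ge0. Qed.

Lemma sqr_enorm n (u : 'rV[R]_n) : enorm u ^+ 2 = dot u u.
Proof. by rewrite sqr_sqrtr ?dot_ge0. Qed.

Lemma enorm0 n : enorm (0 : 'rV[R]_n) = 0.
Proof. by rewrite /enorm dot0l sqrtr0. Qed.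

Lemma enormZ n (a : R) (u : 'rV[R]_n) : enorm (a *: u) = `|a| * enorm u.
Proof.
by rewrite /enorm dotZl dotZr mulrA -expr2 sqrtrM ?sqr_ge0 // sqrtr_sqr.
Qed.

Lemma enorm_leP n (u : 'rV[R]_n) (b : R) :
  0 <= b -> (enorm u <= b) = (dot u u <= b ^+ 2).
Proof.
by move=> b0; rewrite -sqr_enorm ler_pXn2r // ?nnegrE ?enorm_ge0.
Qed.

Lemma enorm_eq0 n (u : 'rV[R]_n) : enorm u = 0 -> u = 0.
Proof.
move=> u_eq0; have uu : dot u u = 0 by rewrite -sqr_enorm u_eq0 expr0n.
apply/rowP => i; rewrite mxE; apply/eqP; rewrite -sqrf_eq0 expr2.
have /psumr_eq0P : forall j, true -> 0 <= u 0 j * u 0 j.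
  by move=> j _; rewrite -expr2 sqr_ge0.
by move=> /(_ uu i isT) ->.
Qed.

(** Cauchy-Schwarz, from the nonnegativity of |a u - b v|^2 at a = |v|, b = |u|. *)
Lemma dot_le_enorm n (u v : 'rV[R]_n) : dot u v <= enorm u * enorm v.
Proof.
have key (a b : R) : 2 * (a * b) * dot u v <= a ^+ 2 * dot u u + b ^+ 2 * dot v v.
  have := dot_ge0 (a *: u - b *: v).
  rewrite dotBl !dotBr !dotZl !dotZr (dotC v u) => h.
  rewrite -subr_ge0; move: h; congr (_ <= _); ring.
have u0 := enorm_ge0 u; have v0 := enorm_ge0 v.
have [/enorm_eq0 ->|u_neq0] := eqVneq (enorm u) 0; first by rewrite dot0l enorm0 mul0r.
have [/enorm_eq0 ->|v_neq0] := eqVneq (enorm v) 0; first by rewrite dot0r enorm0 mulr0.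
have := key (enorm v) (enorm u); rewrite -!sqr_enorm.
have uv : 0 < enorm v * enorm u by rewrite mulr_gt0 // lt_def ?v_neq0 ?u_neq0.
have -> : enorm v ^+ 2 * enorm u ^+ 2 + enorm u ^+ 2 * enorm v ^+ 2 =
  2 * (enorm v * enorm u) * (enorm u * enorm v) by ring.
by rewrite ler_pM2l // mulr_gt0.
Qed.

Lemma enormD n (u v : 'rV[R]_n) : enorm (u + v) <= enorm u + enorm v.
Proof.
rewrite enorm_leP ?addr_ge0 ?enorm_ge0 //.
rewrite dotDl !dotDr (dotC v u) -!sqr_enorm.
have := dot_le_enorm u v; lra.
Qed.

Lemma enormN n (u : 'rV[R]_n) : enorm (- u) = enorm u.
Proof. by rewrite /enorm dotNl dotNr opprK. Qed.

Lemma normr_dot_le n (u v : 'rV[R]_n) : `|dot u v| <= enorm u * enorm v.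
Proof.
rewrite ler_norml dot_le_enorm andbT lerNl -dotNl -(enormN u).
exact: dot_le_enorm.
Qed.

Lemma ler_sqr_norm (a b : R) : 0 <= b -> (a ^+ 2 <= b ^+ 2) = (`|a| <= b).
Proof. by move=> b0; rewrite -[a ^+ 2]real_normK ?num_real // ler_pXn2r ?nnegrE. Qed.

Lemma enormB n (u v : 'rV[R]_n) : enorm (u - v) = enorm (v - u).
Proof. by rewrite -enormN opprB. Qed.

Lemma enorm_sum n (I : Type) (r : seq I) (P : pred I) (f : I -> 'rV[R]_n) :
  enorm (\sum_(i <- r | P i) f i) <= \sum_(i <- r | P i) enorm (f i).
Proof.
elim/big_rec2: _ => [|i a b _ h]; first by rewrite enorm0.
by apply: (le_trans (enormD _ _)); rewrite lerD2l.
Qed.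

Lemma enorm_avg n (I : finType) (f : I -> 'rV[R]_n) (b : R) :
  (0 < #|I|)%N -> (forall i, enorm (f i) <= b) ->
  enorm (#|I|%:R^-1 *: \sum_i f i) <= b.
Proof.
move=> I0 fb; rewrite enormZ ger0_norm ?invr_ge0 ?ler0n //.
rewrite ler_pdivrMl ?ltr0n //; apply: (le_trans (enorm_sum _ _ _)).
apply: (le_trans (ler_sum _ (fun i _ => fb i))).
by rewrite sumr_const mulr_natl.
Qed.

(** Bridge to the topology on row vectors, which is that of the sup norm: Euclidean estimates make
    sequences Cauchy there. *)
Lemma supnorm_le_enorm n (u : 'rV[R]_n) : `|u| <= enorm u.
Proof.
have [->|u0] := eqVneq u 0; first by rewrite normr0 enorm_ge0.
have [|[i j] /= nu] := @mx_norm_neq0 R 1 n u.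
  by apply: contra_neq u0 => /mx_norm_eq0.
rewrite [`|u|]nu -sqrtr_sqr /enorm ler_wsqrtr // (ord1 i) /dot (bigD1 j) //=.
by rewrite -expr2 lerDl; apply: sumr_ge0 => k _; rewrite -expr2 sqr_ge0.
Qed.

Lemma dot_sqrD2 n (u v : 'rV[R]_n) :
  dot (u + v) (u + v) <= 2 * dot u u + 2 * dot v v.
Proof.
have := dot_ge0 (u - v).
rewrite dotBl !dotBr dotDl !dotDr (dotC v u); lra.
Qed.

Lemma dot_sqrD3 n (u v w : 'rV[R]_n) :
  dot (u + v + w) (u + v + w) <= 3 * dot u u + 3 * dot v v + 3 * dot w w.
Proof.
have := dot_ge0 (u - v); have := dot_ge0 (u - w); have := dot_ge0 (v - w).
rewrite !(dotBl, dotBr, dotDl, dotDr) (dotC v u) (dotC w u) (dotC w v); lra.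
Qed.

Lemma young_dot n (b : R) (u v : 'rV[R]_n) :
  0 < b -> dot u v <= b / 2 * dot v v + (2 * b)^-1 * dot u u.
Proof.
move=> b0; have := dot_ge0 (u - b *: v).
rewrite !(dotBl, dotBr, dotZl, dotZr) (dotC v u) => h.
have b2 : 0 < (2 * b)^-1 by rewrite invr_gt0 mulr_gt0.
rewrite -subr_ge0; have := mulr_ge0 (ltW b2) h; congr (_ <= _).
by field; rewrite gt_eqF.
Qed.

Lemma sqr_dist_comb n (t : R) (x y z : 'rV[R]_n) :
  dot (t *: x + (1 - t) *: y - z) (t *: x + (1 - t) *: y - z) =
  t * dot (x - z) (x - z) + (1 - t) * dot (y - z) (y - z)
  - t * (1 - t) * dot (x - y) (x - y).
Proof.
rewrite !(dotBl, dotBr, dotDl, dotDr, dotZl, dotZr).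
rewrite (dotC y x) (dotC z x) (dotC z y); ring.
Qed.

Lemma dot_mulmx p q (A : 'M[R]_(p, q)) (u : 'rV[R]_q) (v : 'rV[R]_p) :
  dot (u *m A^T) v = dot u (v *m A).
Proof.
rewrite /dot; under eq_bigr do rewrite mxE mulr_suml.
rewrite exchange_big; apply: eq_bigr => j _ /=.
by rewrite mxE mulr_sumr; apply: eq_bigr => i _; rewrite !mxE; ring.
Qed.

(** This crude bound shows that the supremum defining [specnorm] is taken over a bounded set,
    without which [sup] would carry no information. *)
Lemma mulmx_frobenius p q (A : 'M[R]_(p, q)) (v : 'rV[R]_q) :
  enorm (v *m A^T) <= Num.sqrt (\sum_i dot (row i A) (row i A)) * enorm v.
Proof.
have s0 : 0 <= \sum_i dot (row i A) (row i A).
  by apply: sumr_ge0 => i _; exact: dot_ge0.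
rewrite enorm_leP ?mulr_ge0 ?sqrtr_ge0 ?enorm_ge0 // exprMn sqr_sqrtr //.
rewrite {1}/dot mulr_suml; apply: ler_sum => i _; rewrite -expr2.
have -> : (v *m A^T) 0 i = dot v (row i A).
  by rewrite mxE; apply: eq_bigr => j _; rewrite !mxE.
rewrite -sqr_enorm -exprMn ler_sqr_norm ?mulr_ge0 ?enorm_ge0 // mulrC.
exact: normr_dot_le.
Qed.

Lemma specnorm_le p q (A : 'M[R]_(p, q)) (v : 'rV[R]_q) :
  enorm (v *m A^T) <= specnorm A * enorm v.
Proof.
set E := [set enorm (v *m A^T) | v in [set v : 'rV[R]_q | enorm v <= 1]].
have supE : has_sup E.
  split; first by exists (enorm ((0 : 'rV[R]_q) *m A^T)); exists 0 => //=; rewrite enorm0.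
  exists (Num.sqrt (\sum_i dot (row i A) (row i A))) => _ [u /= u1 <-].
  apply: (le_trans (mulmx_frobenius _ _)).
  by rewrite ler_piMr ?sqrtr_ge0.
have [v0|v_neq0] := eqVneq (enorm v) 0.
  by have := mulmx_frobenius A v; rewrite v0 !mulr0.
have vgt0 : 0 < enorm v by rewrite lt_def v_neq0 enorm_ge0.
rewrite -ler_pdivrMr // /specnorm -/E mulrC.
have -> : (enorm v)^-1 * enorm (v *m A^T) = enorm (((enorm v)^-1 *: v) *m A^T).
  by rewrite -scalemxAl enormZ ger0_norm ?invr_ge0 ?enorm_ge0.
apply: sup_upper_bound => //; exists ((enorm v)^-1 *: v) => //=.
by rewrite enormZ ger0_norm ?invr_ge0 ?enorm_ge0 // mulVf.
Qed.

Lemma specnorm_ge0 p q (A : 'M[R]_(p, q)) : (0 < q)%N -> 0 <= specnorm A.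
Proof.
move=> q0; pose v : 'rV[R]_q := delta_mx 0 (Ordinal q0).
have v1 : enorm v = 1.
  rewrite /enorm /dot (bigD1 (Ordinal q0)) //= big1 => [|i ni].
    by rewrite /v mxE !eqxx mulr1 addr0 sqrtr1.
  by rewrite /v mxE (negbTE ni) andbF mulr0.
by have := specnorm_le A v; rewrite v1 mulr1; apply: le_trans; exact: enorm_ge0.
Qed.

(** Gradients of compositions are transposed Jacobians applied to vectors, so the adjoint needs the
    same bound. It follows from |A^T u|^2 = <A A^T u, u> <= |A| |A^T u| |u| after cancelling one
    factor. *)
Lemma specnorm_le_tr p q (A : 'M[R]_(p, q)) (u : 'rV[R]_p) : (0 < q)%N ->
  enorm (u *m A) <= specnorm A * enorm u.
Proof.
move=> q0; have [e0|e_neq0] := eqVneq (enorm (u *m A)) 0.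
  by rewrite e0 mulr_ge0 ?enorm_ge0 ?specnorm_ge0.
have egt0 : 0 < enorm (u *m A) by rewrite lt_def e_neq0 enorm_ge0.
rewrite -(ler_pM2l egt0) -expr2 sqr_enorm -dot_mulmx dotC.
apply: (le_trans (dot_le_enorm _ _)).
rewrite mulrCA mulrA [enorm u * _]mulrC ler_wpM2r ?enorm_ge0 //.
exact: specnorm_le.
Qed.

End EuclideanAlgebra.

(** * Gradients, Jacobians and first-order inequalities *)

Section Calculus.
Context {R : realType}.
Implicit Types (n p q : nat).

Lemma continuous_sum_fun (T : topologicalType) (I : finType) (f : I -> T -> R) :
  (forall i, continuous (f i)) -> continuous (fun x => \sum_i f i x).
Proof.
move=> cf; rewrite -fct_sumE; apply: (big_ind (fun g : T -> R => continuous g)).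
- exact: cst_continuous.
- by move=> g h cg ch x; apply: continuousD; [exact: cg|exact: ch].
- by move=> i _; exact: cf.
Qed.

Lemma continuous_dotr n (w : 'rV[R]_n) : continuous (dot w : 'rV[R]_n -> R).
Proof.
apply: (@continuous_sum_fun _ _ (fun i (v : 'rV[R]_n) => w 0 i * v 0 i)) => i u.
by apply: continuousM; [exact: cst_continuous|exact: coord_continuous].
Qed.

Lemma continuous_sqr_dist n (z : 'rV[R]_n) :
  continuous (fun u : 'rV[R]_n => dot (u - z) (u - z)).
Proof.
rewrite /dot; apply: (@continuous_sum_fun _ _
  (fun i (u : 'rV[R]_n) => (u - z) 0 i * (u - z) 0 i)) => i u.
have c : {for u, continuous (fun v : 'rV[R]_n => (v - z) 0 i)}.
  rewrite (_ : (fun v : 'rV[R]_n => _) = (fun v : 'rV[R]_n => v 0 i - z 0 i)).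
    by apply: continuousB; [exact: coord_continuous|exact: cst_continuous].
  by apply/funext => v; rewrite !mxE.
exact: (continuousM c c).
Qed.

Lemma diff_grad n (f : 'rV[R]_n -> R) (x v : 'rV[R]_n) :
  differentiable f x -> 'd f x v = dot (grad f x) v.
Proof.
move=> df; rewrite [v in LHS]row_sum_delta linear_sum.
apply: eq_bigr => i _; rewrite linearZ /= mxE deriveE // mulrC.
by [].
Qed.

Lemma diff_Jac n p (Phi : 'rV[R]_n -> 'rV[R]_p) (x v : 'rV[R]_n) :
  differentiable Phi x -> 'd Phi x v = v *m (Jac Phi x)^T.
Proof. by move=> df; rewrite /Jac trmxK -deriveEjacobian // deriveE. Qed.

Lemma is_derive_line n (W : normedModType R) (f : 'rV[R]_n -> W) (x d : 'rV[R]_n) (s : R) :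
  (forall u, differentiable f u) ->
  is_derive s (1 : R) (fun r : R => f (x + r *: d)) ('d f (x + s *: d) d).
Proof.
move=> df.
have dg : differentiable (fun r : R => x + r *: d) s.
  by apply: differentiableD.
have dfg : differentiable (f \o (fun r : R => x + r *: d)) s.
  by apply: differentiable_comp.
apply: DeriveDef; first exact: diff_derivable.
rewrite deriveE // diff_comp //=; congr ('d f _ _).
have -> : (fun r : R => x + r *: d) = cst x + (fun r : R => r *: d) by [].
have ds : derivable ( *:%R^~ d : R -> 'rV[R]_n) s 1 by exact: diff_derivable.
have dc : derivable (cst x : R -> 'rV[R]_n) s 1 by exact: derivable_cst.
rewrite -(deriveE _ dg) (deriveD dc ds) derive_cst add0r.
by rewrite deriveE // diff_val scale1r.
Qed.

Lemma mean_value_line n (f : 'rV[R]_n -> R) (x y : 'rV[R]_n) :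
  (forall u, differentiable f u) ->
  exists2 s : R, 0 <= s <= 1 & f y - f x = dot (grad f (x + s *: (y - x))) (y - x).
Proof.
move=> df; pose phi (r : R) := f (x + r *: (y - x)).
have dphi (s : R) : is_derive s (1 : R) phi (dot (grad f (x + s *: (y - x))) (y - x)).
  by rewrite -diff_grad //; exact: is_derive_line.
have [|s] := @MVT_segment R phi _ 0 1 ler01 (fun s _ => dphi s).
  apply: derivable_within_continuous => s _.
  exact: (@ex_derive _ _ _ _ _ _ _ (dphi s)).
rewrite in_itv /= => s01 e; exists s => //.
by move: e; rewrite /phi subr0 mulr1 scale1r scale0r addr0 [x + (y - x)]addrC subrK.
Qed.

(** A single mean-value point replaces integration along the segment, hence the constant L instead
    of L/2. The penalty 3L/2 of the y-step leaves room for this. *)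
Lemma smooth_quadratic n (L : R) (f : 'rV[R]_n -> R) (x y : 'rV[R]_n) :
  0 <= L -> (forall u, differentiable f u) -> smooth_fun L f ->
  `|f y - f x - dot (grad f x) (y - x)| <= L * dot (y - x) (y - x).
Proof.
move=> L0 df sf; have [s /andP[s0 s1] ->] := mean_value_line x y df.
rewrite -dotBl; apply: (le_trans (normr_dot_le _ _)).
rewrite -sqr_enorm expr2 mulrA ler_wpM2r ?enorm_ge0 //.
apply: (le_trans (sf _ _)); rewrite ler_wpM2l // addrC addKr enormZ ger0_norm //.
by rewrite ler_piMl ?enorm_ge0.
Qed.

Lemma convex_gradient n (L : R) (f : 'rV[R]_n -> R) (x y : 'rV[R]_n) :
  0 <= L -> (forall u, differentiable f u) -> smooth_fun L f ->
  convex_function [set: 'rV[R]_n] f ->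
  f x + dot (grad f x) (y - x) <= f y.
Proof.
move=> L0 df sf cf; set D := dot (y - x) (y - x).
have D0 : 0 <= D by exact: dot_ge0.
(* Convexity at the point s y + (1 - s) x is combined with the quadratic error at that point and
   divided by s; the remaining error s L D vanishes as s tends to 0. *)
have key (s : R) : 0 < s <= 1 ->
    dot (grad f x) (y - x) <= f y - f x + s * (L * D).
  move=> /andP[s0 s1].
  have s01 : Itv.spec (Itv.num_sem (R := R)) (Itv.Real `[0%Z, 1%Z]) s.
    by rewrite /= /Itv.num_sem /= num_real in_itv /= (ltW s0).
  have := cf (Itv.mk s01) y x (in_setT _) (in_setT _).
  rewrite /conv /= => cfs.
  have := smooth_quadratic x (s *: y + (1 - s) *: x) L0 df sf.
  have -> : s *: y + (1 - s) *: x - x = s *: (y - x).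
    by apply/rowP => i; rewrite !mxE; ring.
  rewrite !dotZl !dotZr -/D => /ler_normlP[h _].
  have cfs' : f (s *: y + (1 - s) *: x) <= s * f y + (1 - s) * f x by [].
  rewrite -(ler_pM2l s0); nra.
rewrite -subr_ge0 -[leRHS]opprK -opprB lerNr oppr0 opprK.
apply/ler_addgt0Pr => e e0.
pose s := Num.min 1 (e / (L * D + 1)).
have LD : 0 < L * D + 1 by rewrite ltr_wpDl ?mulr_ge0.
have s0 : 0 < s by rewrite lt_min ltr01 divr_gt0.
have := key s; rewrite s0 ge_min lexx => /(_ isT).
have : s * (L * D + 1) <= e by rewrite -ler_pdivlMr // ge_min lexx orbT.
nra.
Qed.

(** There is no mean value equality for vector-valued maps, so the map is first paired with w = Phi
    y - Phi x. The scalar theorem then gives |w|^2 = <w, J (y - x)>, and one factor |w| cancels. *)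
Lemma bounded_Jac_lipschitz n p (b : R) (Phi : 'rV[R]_n -> 'rV[R]_p) (x y : 'rV[R]_n) :
  (forall u, differentiable Phi u) -> bounded_Jac b Phi ->
  enorm (Phi y - Phi x) <= b * enorm (y - x).
Proof.
move=> dP bP; set w := Phi y - Phi x.
have [w0|w_neq0] := eqVneq (enorm w) 0.
  rewrite w0; apply: le_trans (enorm_ge0 ((y - x) *m (Jac Phi x)^T)) _.
  by apply: le_trans (specnorm_le _ _) _; rewrite ler_wpM2r ?enorm_ge0.
have w_gt0 : 0 < enorm w by rewrite lt_def w_neq0 enorm_ge0.
pose phi (r : R) := dot w (Phi (x + r *: (y - x))).
have dphi (s : R) : is_derive s (1 : R) phi
    (dot w ((y - x) *m (Jac Phi (x + s *: (y - x)))^T)).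
  have h : is_derive s (1 : R) (fun r : R => Phi (x + r *: (y - x)))
     ('d Phi (x + s *: (y - x)) (y - x)) by exact: is_derive_line.
  rewrite -diff_Jac //; move: h; set g := fun r : R => Phi _; set g' := 'd _ _ _.
  move=> h.
  have lin_w : linear (dot w : 'rV[R]_p -> R).
    by move=> a u v; rewrite dotDr dotZr.
  pose wM := GRing.isLinear.Build _ _ _ _ _ lin_w.
  pose wL : {linear 'rV[R]_p -> R} := HB.pack (dot w) wM.
  have cw : continuous (wL : 'rV[R]_p -> R).
    exact: continuous_dotr.
  have dg : differentiable g s by apply/derivable1_diffP; exact: (@ex_derive _ _ _ _ _ _ _ h).
  have dw u : differentiable (wL : _ -> _) u by exact: linear_differentiable.
  apply: DeriveDef.
    by apply: diff_derivable; apply: (@differentiable_comp _ _ _ _ g wL).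
  rewrite deriveE; last by apply: (@differentiable_comp _ _ _ _ g wL).
  have -> : 'd phi s = 'd wL (g s) \o 'd g s :> (R -> R) by exact: (diff_comp dg (dw _)).
  have -> : 'd wL (g s) = wL :> ('rV[R]_p -> R) by exact: diff_lin.
  rewrite /= -deriveE //; congr (dot w _).
  exact: (@derive_val _ _ _ _ _ _ _ h).
have [|s _] := @MVT_segment R phi _ 0 1 ler01 (fun s _ => dphi s).
  apply: derivable_within_continuous => s _.
  exact: (@ex_derive _ _ _ _ _ _ _ (dphi s)).
rewrite /phi subr0 mulr1 scale1r scale0r addr0 [x + (y - x)]addrC subrK -dotBr.
rewrite -/w -sqr_enorm expr2 => e.
rewrite -(ler_pM2l w_gt0) {}e.
set J := Jac Phi _; have hc := dot_le_enorm w ((y - x) *m J^T).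
apply: (le_trans hc); rewrite ler_wpM2l ?enorm_ge0 //.
apply: (le_trans (specnorm_le _ _)).
by rewrite ler_wpM2r ?enorm_ge0 //; exact: bP.
Qed.

Lemma differentiable_scale_sum n k (W : normedModType R) (a : R)
    (f : 'I_k -> 'rV[R]_n -> W) (x : 'rV[R]_n) :
  (forall i, differentiable (f i) x) ->
  differentiable (fun u => a *: \sum_i f i u) x.
Proof.
move=> df.
have -> : (fun u => a *: \sum_i f i u) = a *: (\sum_i f i).
  by apply/funext => u; rewrite fctE fct_sumE.
by apply: differentiableZ; apply: differentiable_sum.
Qed.

Lemma derive_scale_sum n k (W : normedModType R) (a : R)
    (f : 'I_k -> 'rV[R]_n -> W) (x v : 'rV[R]_n) :
  (forall i, differentiable (f i) x) ->
  'D_v (fun u => a *: \sum_i f i u) x = a *: \sum_i 'D_v (f i) x.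
Proof.
move=> df.
have -> : (fun u => a *: \sum_i f i u) = a *: (\sum_i f i).
  by apply/funext => u; rewrite fctE fct_sumE.
rewrite deriveZ ?derive_sum //.
  by move=> i; apply: diff_derivable.
by apply: derivable_sum => i; apply: diff_derivable.
Qed.

End Calculus.

(** * Chain rule for the finite-sum composition *)

Section Composition.
Context {R : realType} {n1 n2 N1 N2 : nat}.
Variables (F : 'I_n1 -> 'rV[R]_N1 -> R) (G : 'I_n2 -> 'rV[R]_N2 -> 'rV[R]_N1).
Hypothesis dF : forall i u, differentiable (F i) u.
Hypothesis dG : forall j x, differentiable (G j) x.

Lemma differentiable_Favg u : differentiable (Favg F) u.
Proof. exact: (@differentiable_scale_sum _ _ _ R). Qed.

Lemma differentiable_Gavg x : differentiable (Gavg G) x.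
Proof. exact: differentiable_scale_sum. Qed.

Lemma differentiable_fcomp x : differentiable (fcomp F G) x.
Proof.
apply: (@differentiable_comp _ _ _ _ (Gavg G) (Favg F)).
  exact: differentiable_Gavg.
exact: differentiable_Favg.
Qed.

Lemma grad_Favg u : grad (Favg F) u = n1%:R^-1 *: \sum_i grad (F i) u.
Proof.
apply/rowP => k; rewrite mxE (@derive_scale_sum _ _ _ R) //.
by rewrite !mxE summxE; congr (_ * _); apply: eq_bigr => i _; rewrite mxE.
Qed.

Lemma Jac_Gavg x : Jac (Gavg G) x = n2%:R^-1 *: \sum_j Jac (G j) x.
Proof.
apply: trmx_inj; rewrite trmxK; apply/row_matrixP => k.
rewrite !rowE -deriveEjacobian; last exact: differentiable_Gavg.
rewrite derive_scale_sum // linearZ /= -scalemxAr; congr (_ *: _).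
rewrite linear_sum mulmx_sumr; apply: eq_bigr => i _.
by rewrite deriveEjacobian //= trmxK.
Qed.

Lemma grad_fcomp x : grad (fcomp F G) x = grad (Favg F) (Gavg G x) *m Jac (Gavg G) x.
Proof.
apply/rowP => k; rewrite mxE deriveE; last exact: differentiable_fcomp.
rewrite (@diff_comp _ _ _ _ (Gavg G) (Favg F)) /=; first last.
- exact: differentiable_Favg.
- exact: differentiable_Gavg.
rewrite diff_grad; last exact: differentiable_Favg.
rewrite diff_Jac; last exact: differentiable_Gavg.
rewrite mxE; apply: eq_bigr => i _; congr (_ * _).
by rewrite -rowE !mxE.
Qed.

Lemma grad_fcomp_avg x : grad (fcomp F G) x =
  n1%:R^-1 *: \sum_i (grad (F i) (Gavg G x) *m Jac (Gavg G) x).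
Proof. by rewrite grad_fcomp grad_Favg -scalemxAl mulmx_suml. Qed.

(** The Lipschitz hypothesis concerns single pairs (i, j). Averaging over j here, and over i in
    [grad_fcomp_avg], transfers it to the gradient of f. *)
Lemma grad_term_avg i x : grad (F i) (Gavg G x) *m Jac (Gavg G) x =
  n2%:R^-1 *: \sum_j (grad (F i) (Gavg G x) *m Jac (G j) x).
Proof. by rewrite Jac_Gavg -scalemxAr mulmx_sumr. Qed.

End Composition.

(** * Strong convexity and proximal steps *)

Section StrongConvexity.
Context {R : realType} {n : nat}.
Implicit Types (h phi : 'rV[R]_n -> \bar R) (x y z u g : 'rV[R]_n).

(** Only points of the domain are compared, so the inequality is between reals; the finiteness
    clause is the convexity of the domain. *)
Definition sconvex (nu : R) phi : Prop :=
  forall (t : R) x y, 0 <= t <= 1 -> phi x \is a fin_num -> phi y \is a fin_num ->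
  phi (t *: x + (1 - t) *: y) \is a fin_num /\
  fine (phi (t *: x + (1 - t) *: y)) <=
    t * fine (phi x) + (1 - t) * fine (phi y)
    - nu / 2 * (t * (1 - t)) * dot (x - y) (x - y).

Lemma econvex_sconvex h :
  (forall x, h x != -oo%E) -> econvex h -> sconvex 0 h.
Proof.
move=> hN hc t x y t01 hx hy.
have le_h : (h (t *: x + (1 - t) *: y)%R <= (t * fine (h x) + (1 - t) * fine (h y))%R%:E)%E.
  by rewrite EFinD !EFinM !fineK //; exact: hc.
have hfin : h (t *: x + (1 - t) *: y) \is a fin_num.
  by rewrite fin_numE hN /=; apply: contraTneq le_h => ->; rewrite leye_eq.
by split => //; rewrite !mul0r subr0 -lee_fin fineK.
Qed.

Lemma sconvexD (nu nu' : R) (q : 'rV[R]_n -> R) h :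
  (forall (t : R) x y, 0 <= t <= 1 ->
     q (t *: x + (1 - t) *: y) <=
     t * q x + (1 - t) * q y - nu' / 2 * (t * (1 - t)) * dot (x - y) (x - y)) ->
  sconvex nu h -> sconvex (nu' + nu) (fun u => ((q u)%:E + h u)%E).
Proof.
move=> qc hc t x y t01; rewrite !fin_numD /= => hx hy.
have [h1 h2] := hc t x y t01 hx hy; split=> //.
rewrite !fineD //=; have := qc t x y t01; lra.
Qed.

Lemma between_EFin (x : R) (y : \bar R) : (x%:E < y)%E ->
  exists2 b : R, x < b & (b%:E < y)%E.
Proof.
case: y => [y| |//]; rewrite ?lte_fin => xy.
  by exists ((x + y) / 2); rewrite ?lte_fin ?midf_lt.
by exists (x + 1); rewrite ?ltrDl ?ltry.
Qed.

Lemma lower_semicontinuousD (q : 'rV[R]_n -> R) h :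
  continuous q -> lower_semicontinuous h ->
  lower_semicontinuous (fun u => ((q u)%:E + h u)%E).
Proof.
move=> cq lh x a aqh.
have [|b ab bh] := @between_EFin (a - q x) (h x).
  by rewrite EFinB lteBlDl.
have [V nV Vb] := lh x b bh.
have nq : \forall u \near x, a - b < q u.
  by apply: (cvgr_gt (q x) (cq x)); lra.
exists (V `&` [set u | a - b < q u]); first exact: filterI.
move=> y [/Vb hb qy]; rewrite -lteBlDl //.
by apply: le_lt_trans hb; rewrite -EFinB lee_fin; move: qy => /=; lra.
Qed.

(** Strong convexity replaces compactness: at the midpoint of two near-minimizers it bounds their
    squared distance by their excess over the infimum. Minimizing sequences are thus Cauchy, and
    lower semicontinuity makes the limit a minimizer. *)
Lemma sconvex_min (nu c : R) phi : 0 < nu -> sconvex nu phi ->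
  lower_semicontinuous phi -> (forall u, (c%:E <= phi u)%E) ->
  (exists u, phi u \is a fin_num) -> exists z, forall u, (phi z <= phi u)%E.
Proof.
move=> nu0 sc lphi lowphi [u0 u0fin].
pose V := [set fine (phi u) | u in [set u | phi u \is a fin_num]].
have V0 : V !=set0 by exists (fine (phi u0)); exists u0.
have Vlb : has_lbound V.
  by exists c => _ [u /= uf <-]; rewrite -lee_fin fineK.
have infV u : phi u \is a fin_num -> inf V <= fine (phi u).
  by move=> uf; apply: ge_inf => //; exists u.
have /choice[s sP] (k : nat) :
    exists u, phi u \is a fin_num /\ fine (phi u) < inf V + k.+1%:R^-1.
  have [|_ [u uf <-] lt_u] := @inf_adherent R V k.+1%:R^-1 _ (conj V0 Vlb).
    by rewrite invr_gt0 ltr0n.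
  by exists u.
have half01 : 0 <= (2^-1 : R) <= 1 by lra.
have dist k l : nu / 4 * dot (s k - s l) (s k - s l) <= k.+1%:R^-1 + l.+1%:R^-1.
  have [fk lk] := sP k; have [fl ll] := sP l.
  have [mf ml] := sc 2^-1 (s k) (s l) half01 fk fl.
  have := infV _ mf; move: (dot _ _) ml lk ll => d.
  move: (fine (phi (s k))) (fine (phi (s l))) (fine (phi _)) (inf V).
  by move: (k.+1%:R^-1) (l.+1%:R^-1) => r1 r2 a1 a2 a3 i *; lra.
have csq : cauchy (s @ \oo).
  apply: cauchy_exP => e e0.
  have e4 : 0 < nu * e ^+ 2 / 8 by rewrite divr_gt0 // mulr_gt0 // exprn_gt0.
  have [N _ NP] := near_infty_natSinv_lt (PosNum e4).
  exists (s N); exists N => // k Nk /=.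
  have p1 := NP N (leqnn N); have p2 := NP k Nk; move: p1 p2 => /= p1 p2.
  rewrite mx_norm_ball /=; apply: (le_lt_trans (supnorm_le_enorm _)).
  rewrite ltNge; apply/negP => ed.
  have ed2 : e ^+ 2 <= dot (s N - s k) (s N - s k).
    by rewrite -sqr_enorm ler_pXn2r ?nnegrE ?enorm_ge0 // ltW.
  have := dist N k.
  have : nu / 4 * e ^+ 2 <= nu / 4 * dot (s N - s k) (s N - s k).
    by rewrite ler_pM2l // divr_gt0.
  by move: (N.+1%:R^-1) (k.+1%:R^-1) p1 p2 => r1 r2; lra.
have /cauchy_cvgP/cvg_ex[z sz] := csq.
exists z => u.
have zI : (phi z <= (inf V)%:E)%E.
  rewrite leNgt; apply/negP => /between_EFin[b Ib bz].
  have [W nW Wb] := lphi z b bz.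
  have Ib0 : 0 < b - inf V by rewrite subr_gt0.
  near \oo => k.
  have Wk : W (s k) by near: k; exact: sz.
  have [fk lk] := sP k.
  have := Wb _ Wk; rewrite -(fineK fk) lte_fin.
  have : (k.+1%:R : R)^-1 < b - inf V.
    by near: k; have := @near_infty_natSinv_lt R (PosNum Ib0); exact.
  by move: (k.+1%:R^-1) lk => r; lra.
apply: (le_trans zI).
have := lowphi u; have := infV u; case: (phi u) => [r| |] //= h _.
  by rewrite lee_fin h.
by rewrite leey.
Unshelve. all: by end_near. Qed.

(** Minimality of z against t u + (1 - t) z gives, after division by t, the claim with an extra
    factor 1 - t on the quadratic term; then t is taken small. *)
Lemma sconvex_growth (nu : R) phi z u : sconvex nu phi ->
  (forall v, (phi z <= phi v)%E) -> phi z \is a fin_num -> phi u \is a fin_num ->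
  fine (phi z) + nu / 2 * dot (u - z) (u - z) <= fine (phi u).
Proof.
move=> sc zmin zf uf; set D := dot _ _; rewrite -subr_ge0.
have key (t : R) : 0 < t <= 1 -> 0 <= fine (phi u) - fine (phi z) - (1 - t) * (nu / 2 * D).
  move=> /andP[t0 t1]; have t01 : 0 <= t <= 1 by rewrite ltW.
  have [mf ml] := sc t u z t01 uf zf.
  have := zmin (t *: u + (1 - t) *: z); rewrite -(fineK zf) -(fineK mf) lee_fin.
  rewrite -/D in ml => zm; rewrite -(ler_pM2l t0); nra.
rewrite leNgt; apply/negP => neg.
have [D0|D0] := lerP (nu / 2 * D) 0.
  by have := key 1; rewrite ltr01 lexx => /(_ isT); lra.
pose d := fine (phi z) + nu / 2 * D - fine (phi u).
have d0 : 0 < d by rewrite /d; lra.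
pose t := Num.min 1 (d / (nu / 2 * D) / 2).
have t0 : 0 < t by rewrite lt_min ltr01 !divr_gt0.
have := key t; rewrite t0 ge_min lexx => /(_ isT).
have : t * (nu / 2 * D) <= d / 2.
  rewrite -ler_pdivlMr // ge_min; apply/orP; right.
  by rewrite mulrAC.
rewrite /d; lra.
Qed.

(** What a proximal step needs in order to be well defined. The bound [pr_low] is the counterpart of
    an affine minorant: any quadratic penalty dominates it, so proximal objectives are bounded
    below. *)
Record prox_regular (nu : R) h : Prop := ProxRegular {
  pr_sconvex : sconvex nu h;
  pr_lsc : lower_semicontinuous h;
  pr_ninfty : forall x, h x != -oo%E;
  pr_low : exists a b : R, forall u, ((a - b * enorm u)%:E <= h u)%E;
  pr_proper : exists u, h u \is a fin_num }.

Lemma sqr_dist_sconvex (k : R) z (t : R) x y :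
  k * dot (t *: x + (1 - t) *: y - z) (t *: x + (1 - t) *: y - z) <=
  t * (k * dot (x - z) (x - z)) + (1 - t) * (k * dot (y - z) (y - z))
  - (2 * k) / 2 * (t * (1 - t)) * dot (x - y) (x - y).
Proof. by rewrite sqr_dist_comb le_eqVlt; apply/orP; left; apply/eqP; field. Qed.

Lemma argminP phi : (exists z, forall u, (phi z <= phi u)%E) ->
  forall u, (phi (argmin phi) <= phi u)%E.
Proof. exact: (@getPex _ [set z | forall u, (phi z <= phi u)%E]). Qed.

(** The three-point inequality: the proximal objective is strongly convex with modulus 2k from the
    penalty plus nu from h, hence has a minimizer and grows quadratically around it. *)
Lemma proxP (nu k : R) h g z : 0 <= nu -> 0 < k -> prox_regular nu h ->
  let z' := argmin (fun u => ((dot g u + k * enorm (u - z) ^+ 2)%R%:E + h u)%E) in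
  h z' \is a fin_num /\ forall u, h u \is a fin_num ->
  dot g z' + k * dot (z' - z) (z' - z) + fine (h z')
    + (2 * k + nu) / 2 * dot (u - z') (u - z') <=
  dot g u + k * dot (u - z) (u - z) + fine (h u).
Proof.
move=> nu0 k0 [sc lh hN [a [b low]] [u0 u0f]].
set phi := fun u => _; move=> z'.
have phisc : sconvex (2 * k + nu) phi.
  apply: sconvexD sc => t x y t01; rewrite !sqr_enorm.
  have := sqr_dist_sconvex k z t x y; rewrite (dotDr (t *: x)) (dotZr t g) (dotZr _ g); lra.
have philsc : lower_semicontinuous phi.
  apply: lower_semicontinuousD => // u.
  apply: continuousD; first exact: continuous_dotr.
  have -> : (fun v : 'rV[R]_n => k * enorm (v - z) ^+ 2) =
            (fun v => k * dot (v - z) (v - z)).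
    by apply/funext => v; rewrite sqr_enorm.
  by apply: continuousM; [exact: cst_continuous|exact: continuous_sqr_dist].
have minphi : exists z, forall u, (phi z <= phi u)%E.
  (* With s = |u - z| the objective is at least k s^2 - B s up to constants; completing the square
     gives the minimum -B^2/(4k). *)
  pose B := `|b| + enorm g.
  apply: (@sconvex_min _ (a - B * enorm z - B ^+ 2 / (4 * k)) _ _ phisc philsc).
  - by rewrite ltr_wpDr // mulr_gt0.
  - move=> u; rewrite /phi; apply: (@le_trans _ _ ((dot g u + k * enorm (u - z) ^+ 2)%:E + (a - b * enorm u)%:E)%E); last by rewrite leeD2l.
    rewrite -EFinD lee_fin.
    have h1 : - (enorm g * enorm u) <= dot g u.
      by have /ler_normlP[? _] := normr_dot_le g u; lra.
    have h2 : b * enorm u <= `|b| * enorm u by rewrite ler_wpM2r ?enorm_ge0 // ler_norm.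
    have h3 : B * enorm u <= B * (enorm (u - z) + enorm z).
      rewrite ler_wpM2l ?addr_ge0 ?enorm_ge0 //.
      by apply: le_trans (enormD _ _); rewrite subrK.
    have h4 : 0 <= k * (enorm (u - z) - B / (2 * k)) ^+ 2 by rewrite mulr_ge0 ?sqr_ge0 // ltW.
    have h5 : k * (enorm (u - z) - B / (2 * k)) ^+ 2 =
       k * enorm (u - z) ^+ 2 - B * enorm (u - z) + B ^+ 2 / (4 * k).
      by field; rewrite gt_eqF.
    move: h1 h2 h3 h4; rewrite h5 /B; lra.
  - by exists u0; rewrite /phi fin_numD.
have z'min := argminP minphi.
have z'f : h z' \is a fin_num.
  rewrite fin_numE hN /=; apply/negP => /eqP hz.
  have := z'min u0; rewrite -/z' /phi hz addey // leye_eq.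
  by rewrite -(fineK u0f).
split=> // u uf.
have := @sconvex_growth (2 * k + nu) phi z' u phisc z'min.
rewrite /phi !fin_numD /= => /(_ z'f uf).
rewrite !fineD //= !sqr_enorm; lra.
Qed.

End StrongConvexity.

(** * Uniform averages and the gradient estimator *)

Section Averages.
Context {R : realType}.
Implicit Types (T W : finType).

Definition avg T (X : T -> R) : R := #|T|%:R^-1 * \sum_t X t.

Lemma eq_avg T (X Y : T -> R) : X =1 Y -> avg X = avg Y.
Proof. by move=> XY; rewrite /avg (eq_bigr _ (fun t _ => XY t)). Qed.

Lemma avgD T (X Y : T -> R) : avg (fun t => X t + Y t) = avg X + avg Y.
Proof. by rewrite /avg big_split mulrDr. Qed.

Lemma avgZ T (a : R) (X : T -> R) : avg (fun t => a * X t) = a * avg X.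
Proof. by rewrite /avg -mulr_sumr mulrCA. Qed.

Lemma avg_sum T (I : finType) (X : I -> T -> R) :
  avg (fun t => \sum_i X i t) = \sum_i avg (X i).
Proof. by rewrite /avg exchange_big mulr_sumr. Qed.

Lemma avg_le T (X Y : T -> R) : (forall t, X t <= Y t) -> avg X <= avg Y.
Proof.
by move=> XY; rewrite ler_wpM2l ?invr_ge0 ?ler0n //; apply: ler_sum.
Qed.

Lemma avg_cst T (a : R) : (0 < #|T|)%N -> avg (fun _ : T => a) = a.
Proof.
by move=> T0; rewrite /avg sumr_const -[a *+ _]mulr_natl mulrA mulVf ?mul1r // pnatr_eq0 -lt0n.
Qed.

Lemma avg_le_cst T (X : T -> R) (a : R) :
  (0 < #|T|)%N -> (forall t, X t <= a) -> avg X <= a.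
Proof. by move=> T0 Xa; rewrite -[leRHS](@avg_cst T) //; exact: avg_le. Qed.

Lemma avg_pair T W (X : T * W -> R) :
  avg X = avg (fun t => avg (fun w => X (t, w))).
Proof.
rewrite /avg -mulr_sumr pair_bigA /= card_prod natrM invfM mulrA.
by congr (_ * _); apply: eq_bigr => -[].
Qed.

Lemma avg_exchange T W (X : T -> W -> R) :
  avg (fun t => avg (X t)) = avg (fun w => avg (X ^~ w)).
Proof.
rewrite /avg -!mulr_sumr exchange_big /= !mulrA; congr (_ * _).
by rewrite mulrC.
Qed.

(* [upd w v] replaces the coordinate [pi w] of [w] by [v].  Averaging over an
   independent copy [v] of that coordinate changes nothing: (w, v) |-> (upd w v, pi w)
   is an involution. *)
Lemma sum_resample T W (pi : T -> W) (upd : T -> W -> T) (P : pred T)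
    (g : T -> W -> R) : (0 < #|W|)%N ->
  (forall w v, pi (upd w v) = v) -> (forall w v, upd (upd w v) (pi w) = w) ->
  (forall w v, P (upd w v) = P w) -> (forall w v, g (upd w v) =1 g w) ->
  \sum_(w | P w) g w (pi w) = \sum_(w | P w) avg (g w).
Proof.
move=> W0 piK updK Pupd gupd; rewrite /avg -mulr_sumr.
have Wn0 : #|W|%:R != 0 :> R by rewrite pnatr_eq0 -lt0n.
apply: (mulfI Wn0); rewrite mulVKf //.
rewrite pair_big /=.
pose phi (p : T * W) := (upd p.1 p.2, pi p.1).
have phiK : involutive phi by case=> w v; rewrite /phi /= updK piK.
rewrite [RHS](reindex_inj (inv_inj phiK)) /=.
rewrite [RHS](eq_big (fun p => P p.1 && xpredT p.2) (fun p => g p.1 (pi p.1))); first last.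
- by move=> [w v] _; rewrite /= gupd.
- by move=> [w v]; rewrite /= Pupd.
rewrite -(pair_big P xpredT (fun w _ => g w (pi w))) /= mulr_sumr.
by apply: eq_bigr => w _; rewrite sumr_const mulr_natl.
Qed.

(** The family is dependent because batch sizes, and so the sample space of a SoCK call, change from
    one round of NoCK to the next. *)
Definition updf (I : finType) (W : I -> Type) (i : I)
    (w : {ffun forall j, W j}) (v : W i) : {ffun forall j, W j} :=
  [ffun j => @eqtype.dfwith I W w i v j].

Lemma updf_eq (I : finType) (W : I -> Type) (i : I) (w : {ffun forall j, W j}) (v : W i) :
  updf w v i = v.
Proof. by rewrite ffunE eqtype.dfwith_in. Qed.

Lemma updf_neq (I : finType) (W : I -> Type) (i j : I) (w : {ffun forall j, W j}) (v : W i) :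
  j != i -> updf w v j = w j.
Proof. by move=> ji; rewrite ffunE eqtype.dfwith_out // eq_sym. Qed.

Lemma updfK (I : finType) (W : I -> Type) (i : I) (w : {ffun forall j, W j}) (v : W i) :
  updf (updf w v) (w i) = w.
Proof.
apply/ffunP => j; have [->|ji] := eqVneq j i; first by rewrite updf_eq.
by rewrite !updf_neq.
Qed.

(** The tower property for a fresh draw: when [g w] ignores coordinate i of w, that coordinate may
    be averaged first. *)
Lemma avg_resample (I : finType) W (i : I) (g : {ffun I -> W} -> W -> R) :
  (0 < #|W|)%N ->
  (forall w (v : W), g (@updf I (fun _ => W) i w v) =1 g w) ->
  avg (fun w => g w (w i)) = avg (fun w => avg (g w)).
Proof.
move=> W0 gu; rewrite /avg -(@sum_resample _ _ (fun w : {ffun I -> W} => w i)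
  (fun w v => @updf I (fun _ => W) i w v) xpredT g) //.
- by move=> w v; exact: (@updf_eq I (fun _ => W)).
- by move=> w v; exact: (@updfK I (fun _ => W)).
Qed.

Lemma card_ffun_gt0 (I W : finType) : (0 < #|W|)%N -> (0 < #|{ffun I -> W}|)%N.
Proof. by move=> W0; rewrite card_ffun expn_gt0 W0. Qed.

Lemma avg_coord (I : finType) W (i : I) (X : W -> R) : (0 < #|W|)%N ->
  avg (fun w : {ffun I -> W} => X (w i)) = avg X.
Proof.
move=> W0; rewrite (@avg_resample I W i (fun _ => X)) //.
by rewrite avg_cst //; exact: card_ffun_gt0.
Qed.

(** Centering only lowers the second moment, and the cross terms of independent centered draws
    vanish, so k of the k^2 products remain. *)
Lemma variance_mean n (k : nat) (J : finType) (xi : J -> 'rV[R]_n) (b : R) :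
  (0 < k)%N -> (0 < #|J|)%N -> (forall j, dot (xi j) (xi j) <= b) ->
  avg (fun w : {ffun 'I_k -> J} =>
    dot (k%:R^-1 *: \sum_i xi (w i) - #|J|%:R^-1 *: \sum_j xi j)
        (k%:R^-1 *: \sum_i xi (w i) - #|J|%:R^-1 *: \sum_j xi j))
  <= b / k%:R.
Proof.
move=> k0 J0 xib; set mean := #|J|%:R^-1 *: _; pose a j := xi j - mean.
have Jn0 : #|J|%:R != 0 :> R by rewrite pnatr_eq0 -lt0n.
have kn0 : k%:R != 0 :> R by rewrite pnatr_eq0 -lt0n.
have suma : \sum_j a j = 0.
  rewrite sumrB sumr_const -scaler_nat /mean scalerA mulfV // scale1r subrr.
  by [].
have avga : avg (fun j => dot (a j) (a j)) <= b.
  have -> : avg (fun j => dot (a j) (a j)) =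
            avg (fun j => dot (xi j) (xi j)) - dot mean mean.
    transitivity (avg (fun j => dot (xi j) (xi j) + dot mean mean + (- 2) * dot (xi j) mean)).
      by apply: eq_avg => j; rewrite /a dotBl !dotBr (dotC mean); ring.
    rewrite !avgD avgZ avg_cst //.
    suff -> : avg (fun j => dot (xi j) mean) = dot mean mean by ring.
    by rewrite /avg -dot_suml -dotZl.
  by apply: (@le_trans _ _ (avg (fun j => dot (xi j) (xi j))));
    rewrite ?gerBl ?dot_ge0 // avg_le_cst.
have cross (i l : 'I_k) : avg (fun w : {ffun 'I_k -> J} => dot (a (w i)) (a (w l))) =
    if i == l then avg (fun j => dot (a j) (a j)) else 0.
  have [<-|il] := eqVneq i l; first exact: (avg_coord i (fun j => dot (a j) (a j))).
  rewrite (@avg_resample _ _ i (fun w v => dot (a v) (a (w l)))) //.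
    rewrite -[RHS](@avg_cst {ffun 'I_k -> J}); last exact: card_ffun_gt0.
    by apply: eq_avg => w; rewrite /avg -dot_suml suma dot0l mulr0.
  by move=> w v u; rewrite (@updf_neq _ (fun _ => J)) // eq_sym.
have -> : avg (fun w : {ffun 'I_k -> J} =>
    dot (k%:R^-1 *: \sum_i xi (w i) - mean) (k%:R^-1 *: \sum_i xi (w i) - mean)) =
  k%:R^-1 ^+ 2 * avg (fun w : {ffun 'I_k -> J} =>
     \sum_i \sum_l dot (a (w i)) (a (w l))).
  rewrite -avgZ; apply: eq_avg => w.
  have -> : k%:R^-1 *: \sum_i xi (w i) - mean = k%:R^-1 *: \sum_i a (w i).
    rewrite /a sumrB scalerBr sumr_const card_ord -[mean *+ k]scaler_nat.
    by rewrite [X in _ = _ - X]scalerA mulVf // scale1r.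
  rewrite dotZl dotZr mulrA -expr2 dot_suml; congr (_ * _).
  by apply: eq_bigr => i _; rewrite dot_sumr.
rewrite avg_sum.
have -> : \sum_i avg (fun w : {ffun 'I_k -> J} => \sum_l dot (a (w i)) (a (w l))) =
   k%:R * avg (fun j => dot (a j) (a j)).
  under eq_bigr => i _.
    rewrite avg_sum (bigD1 i) //= cross eqxx big1 ?addr0; last first.
      by move=> l li; rewrite cross eq_sym (negbTE li).
    over.
  by rewrite sumr_const card_ord mulr_natl.
rewrite expr2 -mulrA mulKf // mulrC ler_wpM2r // invr_ge0 ler0n.
Qed.

End Averages.

Lemma enorm_avg_ord (R : realType) n k (f : 'I_k -> 'rV[R]_n) (b : R) :
  (0 < k)%N -> (forall i, enorm (f i) <= b) ->
  enorm (k%:R^-1 *: \sum_i f i) <= b.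
Proof. by move=> k0 fb; rewrite -[k in k%:R](card_ord k) enorm_avg ?card_ord. Qed.

Lemma mulmx_scale_sumB (R : realType) p q (I J : finType) (a b : R) (v : 'rV[R]_p)
    (M : I -> 'M[R]_(p, q)) (D : J -> 'M[R]_(p, q)) :
  v *m (b *: (\sum_i M i) - a *: (\sum_j D j)) =
  b *: (\sum_i v *m M i) - a *: (\sum_j v *m D j).
Proof. by rewrite mulmxBr -!scalemxAr !mulmx_sumr. Qed.

(** * Mean squared error of the mini-batch gradient estimator *)

Section Estimator.
Context {R : realType} {n1 n2 N1 N2 : nat}.
Variables (F : 'I_n1 -> 'rV[R]_N1 -> R) (G : 'I_n2 -> 'rV[R]_N2 -> 'rV[R]_N1).
Variables (L LF BF LG BG : R).
Hypotheses (n1_gt0 : (0 < n1)%N) (n2_gt0 : (0 < n2)%N) (N2_gt0 : (0 < N2)%N).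
Hypothesis dF : forall i u, differentiable (F i) u.
Hypothesis dG : forall j x, differentiable (G j) x.
Hypothesis smF : forall i, smooth_fun LF (F i).
Hypothesis bF : forall i, bounded_grad BF (F i).
Hypothesis smG : forall j, smooth_map LG (G j).
Hypothesis bG : forall j, bounded_Jac BG (G j).
Hypothesis lipFG : forall i j x y,
  enorm (grad (F i) (Gavg G x) *m Jac (G j) x
         - grad (F i) (Gavg G y) *m Jac (G j) y) <= L * enorm (x - y).

Lemma BG_ge0 : 0 <= BG.
Proof. exact: le_trans (specnorm_ge0 _ N2_gt0) (bG (Ordinal n2_gt0) 0). Qed.

Lemma grad_term_lipschitz i x y :
  enorm (grad (F i) (Gavg G x) *m Jac (Gavg G) x
         - grad (F i) (Gavg G y) *m Jac (Gavg G) y) <= L * enorm (x - y).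
Proof.
rewrite (grad_term_avg F dG i x) (grad_term_avg F dG i y) -scalerBr -sumrB.
exact: enorm_avg_ord.
Qed.

Lemma fcomp_smooth : smooth_fun L (fcomp F G).
Proof.
move=> x y; rewrite (grad_fcomp_avg dF dG x) (grad_fcomp_avg dF dG y) -scalerBr -sumrB.
apply: enorm_avg_ord => // i; exact: grad_term_lipschitz.
Qed.

Lemma Jac_Gavg_bounded x u : enorm (u *m Jac (Gavg G) x) <= BG * enorm u.
Proof.
rewrite (Jac_Gavg dG) -scalemxAr mulmx_sumr.
apply: enorm_avg_ord => // j.
apply: (le_trans (specnorm_le_tr _ _ N2_gt0)).
by rewrite ler_wpM2r ?enorm_ge0 //; exact: bG.
Qed.

Lemma grad_fcomp_bounded x : enorm (grad (fcomp F G) x) <= BG * BF.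
Proof.
rewrite (grad_fcomp_avg dF dG).
apply: enorm_avg_ord => // i.
apply: (le_trans (Jac_Gavg_bounded _ _)); rewrite ler_wpM2l ?BG_ge0 //.
exact: bF.
Qed.

Variables (A B C : nat).
Hypotheses (A_gt0 : (0 < A)%N) (B_gt0 : (0 < B)%N) (C_gt0 : (0 < C)%N).

(** [Ghat], [Jhat] and [grad_est] reproduce the local definitions of [SoCK_step], so that the step
    unfolds to them by computation. *)
Definition Ghat (x xt : 'rV[R]_N2) (wA : {ffun 'I_A -> 'I_n2}) :=
  A%:R^-1 *: (\sum_(i < A) (G (wA i) x - G (wA i) xt)) + Gavg G xt.

Definition Jhat (x xt : 'rV[R]_N2) (wB : {ffun 'I_B -> 'I_n2}) :=
  B%:R^-1 *: (\sum_(i < B) (Jac (G (wB i)) x - Jac (G (wB i)) xt)) + Jac (Gavg G) xt.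

Definition grad_est (x xt : 'rV[R]_N2) (w : @draws n1 n2 A B C) : 'rV[R]_N2 :=
  let: (wA, wB, wC) := w in
  C%:R^-1 *: (\sum_(i < C) (grad (F (wC i)) (Ghat x xt wA) *m Jhat x xt wB
                          - grad (F (wC i)) (Gavg G xt) *m Jac (Gavg G) xt))
           + grad (fcomp F G) xt.

(** Exact quantities replace estimates one at a time: first the Jacobian ([e1]), then the inner
    value ([e2]), leaving the sampling of the F_i ([e3]). [e1] and [e3] have mean zero; the bias
    sits in [e2], where the estimated inner value passes through nonlinear gradients. *)
Let e1 x xt wA wB (wC : {ffun 'I_C -> 'I_n1}) :=
  (C%:R^-1 *: \sum_i grad (F (wC i)) (Ghat x xt wA)) *m (Jhat x xt wB - Jac (Gavg G) x).
Let e2 x xt wA (wC : {ffun 'I_C -> 'I_n1}) :=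
  (C%:R^-1 *: \sum_i (grad (F (wC i)) (Ghat x xt wA) - grad (F (wC i)) (Gavg G x)))
   *m Jac (Gavg G) x.
Let e3 x xt (wC : {ffun 'I_C -> 'I_n1}) :=
  C%:R^-1 *: (\sum_(i < C) (grad (F (wC i)) (Gavg G x) *m Jac (Gavg G) x
                          - grad (F (wC i)) (Gavg G xt) *m Jac (Gavg G) xt))
  - (grad (fcomp F G) x - grad (fcomp F G) xt).

Lemma grad_est_error x xt wA wB wC :
  grad_est x xt (wA, wB, wC) - grad (fcomp F G) x =
  e1 x xt wA wB wC + e2 x xt wA wC + e3 x xt wC.
Proof.
rewrite /grad_est /e1 /e2 /e3 -!scalemxAl !mulmx_suml.
rewrite opprB !addrA -!scalerDr -!big_split /=.
congr (_ *: _ + _ - _).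
by apply: eq_bigr => i _; rewrite mulmxBr mulmxBl !addrA !subrK.
Qed.

Lemma sqr_le_of_enorm n (u : 'rV[R]_n) (b : R) : enorm u <= b -> dot u u <= b ^+ 2.
Proof.
by move=> ub; rewrite -enorm_leP //; exact: le_trans (enorm_ge0 _) ub.
Qed.

Lemma avg_e3 x xt : avg (fun wC => dot (e3 x xt wC) (e3 x xt wC)) <=
  (L * enorm (x - xt)) ^+ 2 / C%:R.
Proof.
pose xi i := grad (F i) (Gavg G x) *m Jac (Gavg G) x
  - grad (F i) (Gavg G xt) *m Jac (Gavg G) xt.
have := @variance_mean R N2 C _ xi ((L * enorm (x - xt)) ^+ 2) C_gt0.
rewrite card_ord => /(_ n1_gt0 (fun i => sqr_le_of_enorm (grad_term_lipschitz i x xt))).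
congr (_ <= _); apply: eq_avg => wC; rewrite /e3.
by rewrite (grad_fcomp_avg dF dG x) (grad_fcomp_avg dF dG xt) -scalerBr -sumrB.
Qed.

Lemma avg_Ghat x xt :
  avg (fun wA => dot (Ghat x xt wA - Gavg G x) (Ghat x xt wA - Gavg G x)) <=
  (BG * enorm (x - xt)) ^+ 2 / A%:R.
Proof.
pose xi j := G j x - G j xt.
have xib j : dot (xi j) (xi j) <= (BG * enorm (x - xt)) ^+ 2.
  by apply: sqr_le_of_enorm; apply: bounded_Jac_lipschitz.
have := @variance_mean R N1 A _ xi _ A_gt0.
rewrite card_ord => /(_ _ n2_gt0 xib).
congr (_ <= _); apply: eq_avg => wA; rewrite /Ghat /xi.
have E : Gavg G xt - Gavg G x = - (n2%:R^-1 *: \sum_j (G j x - G j xt)).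
  rewrite /Gavg -scalerBr -sumrB -scalerN -sumrN; congr (_ *: _).
  by apply: eq_bigr => j _; rewrite opprB.
by rewrite -addrA E.
Qed.

Lemma avg_e2 x xt wC : (0 < N1)%N ->
  avg (fun wA => dot (e2 x xt wA wC) (e2 x xt wA wC)) <=
  (BG * LF) ^+ 2 * ((BG * enorm (x - xt)) ^+ 2 / A%:R).
Proof.
move=> N1_gt0.
apply: (@le_trans _ _ ((BG * LF) ^+ 2 *
  avg (fun wA => dot (Ghat x xt wA - Gavg G x) (Ghat x xt wA - Gavg G x)))).
  rewrite -avgZ; apply: avg_le => wA; rewrite -[dot (Ghat _ _ _ - _) _]sqr_enorm -exprMn.
  apply: sqr_le_of_enorm; apply: (le_trans (Jac_Gavg_bounded _ _)).
  rewrite -mulrA ler_wpM2l ?BG_ge0 //.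
  by apply: enorm_avg_ord => // i; exact: smF.
by rewrite ler_wpM2l ?sqr_ge0 // avg_Ghat.
Qed.

Lemma avg_e1 x xt wA wC :
  avg (fun wB => dot (e1 x xt wA wB wC) (e1 x xt wA wB wC)) <=
  (LG * enorm (x - xt) * BF) ^+ 2 / B%:R.
Proof.
(* The draws wB are independent of v, so the variance of the vectors v *m Jac is
   enough: no dimension-dependent bound on the variance of a random matrix. *)
set v := C%:R^-1 *: \sum_i grad (F (wC i)) (Ghat x xt wA).
have vb : enorm v <= BF.
  by apply: enorm_avg_ord => // i; exact: bF.
pose xi j := v *m (Jac (G j) x - Jac (G j) xt).
have xib j : dot (xi j) (xi j) <= (LG * enorm (x - xt) * BF) ^+ 2.
  apply: sqr_le_of_enorm; apply: (le_trans (specnorm_le_tr _ _ N2_gt0)).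
  by apply: ler_pM; rewrite ?specnorm_ge0 ?enorm_ge0 //; exact: smG.
have := @variance_mean R N2 B _ xi _ B_gt0.
rewrite card_ord => /(_ _ n2_gt0 xib).
have E : Jac (Gavg G) xt - Jac (Gavg G) x =
    - (n2%:R^-1 *: \sum_j (Jac (G j) x - Jac (G j) xt)).
  rewrite (Jac_Gavg dG x) (Jac_Gavg dG xt) -scalerBr -sumrB -scalerN -sumrN.
  by congr (_ *: _); apply: eq_bigr => j _; rewrite opprB.
have E2 wB : Jhat x xt wB - Jac (Gavg G) x =
    B%:R^-1 *: (\sum_i (Jac (G (wB i)) x - Jac (G (wB i)) xt))
    - n2%:R^-1 *: \sum_j (Jac (G j) x - Jac (G j) xt).
  by rewrite /Jhat -addrA; congr (_ + _); exact: E.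
have E3 wB : e1 x xt wA wB wC = B%:R^-1 *: (\sum_i xi (wB i)) - n2%:R^-1 *: \sum_j xi j.
  by rewrite /e1 -/v E2 mulmx_scale_sumB.
by congr (_ <= _); apply: eq_avg => wB; rewrite E3.
Qed.

Lemma grad_est_variance x xt : (0 < N1)%N ->
  avg (fun w => dot (grad_est x xt w - grad (fcomp F G) x)
                    (grad_est x xt w - grad (fcomp F G) x)) <=
  3 * (BF ^+ 2 * LG ^+ 2 / B%:R + BG ^+ 4 * LF ^+ 2 / A%:R + L ^+ 2 / C%:R)
    * dot (x - xt) (x - xt).
Proof.
move=> N1_gt0.
have cA : (0 < #|{ffun 'I_A -> 'I_n2}|)%N by apply: card_ffun_gt0; rewrite card_ord.
have cB : (0 < #|{ffun 'I_B -> 'I_n2}|)%N by apply: card_ffun_gt0; rewrite card_ord.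
have cC : (0 < #|{ffun 'I_C -> 'I_n1}|)%N by apply: card_ffun_gt0; rewrite card_ord.
apply: (@le_trans _ _ (avg (fun w : @draws n1 n2 A B C => 3 * dot (e1 x xt w.1.1 w.1.2 w.2) (e1 x xt w.1.1 w.1.2 w.2)
  + 3 * dot (e2 x xt w.1.1 w.2) (e2 x xt w.1.1 w.2) + 3 * dot (e3 x xt w.2) (e3 x xt w.2)))).
  by apply: avg_le => -[[wA wB] wC]; rewrite grad_est_error dot_sqrD3.
rewrite !avgD !avgZ.
suff : [/\ avg (fun w : @draws n1 n2 A B C => dot (e1 x xt w.1.1 w.1.2 w.2) (e1 x xt w.1.1 w.1.2 w.2))
      <= BF ^+ 2 * LG ^+ 2 / B%:R * dot (x - xt) (x - xt),
    avg (fun w : @draws n1 n2 A B C => dot (e2 x xt w.1.1 w.2) (e2 x xt w.1.1 w.2))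
      <= BG ^+ 4 * LF ^+ 2 / A%:R * dot (x - xt) (x - xt) &
    avg (fun w : @draws n1 n2 A B C => dot (e3 x xt w.2) (e3 x xt w.2))
      <= L ^+ 2 / C%:R * dot (x - xt) (x - xt)].
  move: (avg _) (avg _) (avg _) => a1 a2 a3 [].
  move: (_ / A%:R) (_ / B%:R) (_ / C%:R) (dot _ _) => pA pB pC d; lra.
split.
(* The averages are reordered so that the batch responsible for the error is innermost; the bound is
   uniform in the other two. *)
- rewrite avg_pair avg_pair /=; apply: avg_le_cst => // wA.
  rewrite avg_exchange; apply: avg_le_cst => // wC.
  apply: (le_trans (avg_e1 _ _ _ _)); rewrite !exprMn sqr_enorm.
  by rewrite le_eqVlt; apply/orP; left; apply/eqP; ring.
- rewrite avg_pair avg_pair /= avg_exchange; apply: avg_le_cst => // wB.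
  rewrite avg_exchange; apply: avg_le_cst => // wC.
  apply: (le_trans (avg_e2 _ _ _ N1_gt0)); rewrite !exprMn sqr_enorm.
  by rewrite le_eqVlt; apply/orP; left; apply/eqP; ring.
- rewrite avg_pair /=; apply: avg_le_cst; first by rewrite card_prod muln_gt0 cA.
  move=> _; apply: (le_trans (avg_e3 _ _)); rewrite !exprMn sqr_enorm.
  by rewrite le_eqVlt; apply/orP; left; apply/eqP; ring.
Qed.

End Estimator.

(** * SoCK *)

Section SequenceBound.
Context {R : realType}.

(* Weighting step j by theta^j makes the z-terms telescope; the y-terms lose
   7/4 tau per step. *)
Lemma weighted_telescope (m : nat) (tau p q D : R) (E V : nat -> R) :
  0 < tau <= 2^-1 -> 0 <= p -> 0 <= q -> p * tau <= 3 * q ->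
  (forall j, 0 <= E j) -> (forall j, 0 <= V j) ->
  (forall j, (j < m)%N -> E j.+1 + (p + q) * V j.+1 <=
     13 / 12 * tau * D + (1 - 23 / 12 * tau) * E j + (p + q / 3) * V j) ->
  7 / 4 * tau * (\sum_(j < m) (1 + tau / 6) ^+ j * E j.+1)
    + (1 + tau / 6) ^+ m * ((1 - 23 / 12 * tau) * E m + (p + q / 3) * V m) <=
  13 / 12 * tau * D * (\sum_(j < m) (1 + tau / 6) ^+ j)
    + (1 - 23 / 12 * tau) * E 0%N + (p + q / 3) * V 0%N.
Proof.
move=> /andP[t0 t1] p0 q0 pq E0 V0 step; set theta := 1 + tau / 6.
elim: m step => [|m IH] step.
  by rewrite !big_ord0 expr0 !mulr0 mul1r !add0r.
have {IH} := IH (fun j jm => step j (leqW jm)).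
rewrite !big_ord_recr /= exprS; have := step m (ltnSn m).
have th0 : 0 < theta ^+ m by rewrite exprn_gt0 // /theta; lra.
move: (theta ^+ m) th0 => w w0; move: (\sum_(_ < _) _) => s1; move: (\sum_(_ < _) _) => s2.
move: (E m) (E m.+1) (V m) (V m.+1) (E0 m.+1) (V0 m.+1) => e e' v v' e'0 v'0 st IH.
have st' := ler_wpM2l (ltW w0) st.
(* (1 + tau/6)(1 - 23/12 tau) = 1 - 7/4 tau - 23/72 tau^2. For the z-terms below, p tau <= 3 q turns
   the extra p tau/6 into at most q/2, which fits between q/3 and q. *)
have h1 : w * e' * (7 / 4 * tau + theta * (1 - 23 / 12 * tau)) <= w * e' * 1.
  rewrite ler_wpM2l ?mulr_ge0 ?(ltW w0) // /theta.
  have := sqr_ge0 tau; lra.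
have h2 : w * v' * (theta * (p + q / 3)) <= w * v' * (p + q).
  rewrite ler_wpM2l ?mulr_ge0 ?(ltW w0) // /theta.
  have : q * tau <= q * 2^-1 by rewrite ler_wpM2l.
  lra.
move: st' h1 h2 IH; lra.
Qed.

(** Bernoulli's inequality. At k = m it reads theta^m >= 13/12, the source of the contraction per
    outer loop. *)
Lemma theta_pow_ge (m k : nat) : (0 < m)%N ->
  1 + k%:R / (12 * m%:R) <= (1 + (12 * m%:R)^-1 : R) ^+ k.
Proof.
move=> m0; have r0 : 0 < (12 * m%:R : R)^-1 by rewrite invr_gt0 mulr_gt0 // ltr0n.
move: (_^-1) r0 => r r0; elim: k => [|k IH]; first by rewrite mul0r addr0 expr0.
rewrite exprS -natr1; have := ler_wpM2l (ltW (addr_gt0 ltr01 r0)) IH.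
have : 0 <= k%:R * (r * r) by rewrite !mulr_ge0 ?ler0n ?ltW.
lra.
Qed.

Lemma theta_pow_le (m k : nat) : (k <= m)%N -> (0 < m)%N ->
  (1 + (12 * m%:R)^-1 : R) ^+ k <= 1 + 2 * k%:R / (12 * m%:R).
Proof.
move=> + m0; set r := (12 * m%:R)^-1.
have m0R : 0 < (m%:R : R) by rewrite ltr0n.
have r0 : 0 < r by rewrite invr_gt0 mulr_gt0.
have mr : 12 * m%:R * r = 1 by rewrite mulfV // gt_eqF // mulr_gt0.
elim: k => [|k IH] km; first by rewrite mulr0 mul0r addr0 expr0.
rewrite exprS -natr1.
have := ler_wpM2l (ltW (addr_gt0 ltr01 r0)) (IH (ltnW km)).
have km' : (k%:R : R) <= m%:R by rewrite ler_nat ltnW.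
have : 2 * k%:R * (r * r) <= r.
  rewrite mulrA -[leRHS]mul1r ler_wpM2r ?(ltW r0) //.
  have := ler_wpM2r (ltW r0) km'; move: mr; nra.
lra.
Qed.

End SequenceBound.

Lemma avg_lin3 (R : realType) (T : finType) (a b d : R) (X Y Z : T -> R) :
  avg (fun w => a * X w + b * Y w + d * Z w) = a * avg X + b * avg Y + d * avg Z.
Proof. by rewrite !avgD !avgZ. Qed.

Section FoldOrd.
Variables (S : Type) (n : nat).
Implicit Types (f g : S -> 'I_n -> S) (s : S).

Lemma foldl_take_ordS f s (k : 'I_n) :
  foldl f s (take k.+1 (enum 'I_n)) = f (foldl f s (take k (enum 'I_n))) k.
Proof.
rewrite (take_nth k) ?size_enum_ord // foldl_rcons.
by rewrite (nth_ord_enum k k).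
Qed.

(** Adaptedness: the state after k steps depends only on the draws of index below k. This makes
    resampling draw k harmless. *)
Lemma eq_foldl_take f g s (k : nat) :
  (forall s (j : 'I_n), (j < k)%N -> f s j = g s j) ->
  foldl f s (take k (enum 'I_n)) = foldl g s (take k (enum 'I_n)).
Proof.
elim: k => [|k IH] fg; first by rewrite !take0.
have [kn|nk] := ltnP k n; last first.
  rewrite !take_oversize ?size_enum_ord ?(leqW nk) //.
  have := IH (fun s j jk => fg s j (ltnW jk)).
  by rewrite !take_oversize ?size_enum_ord.
have := @foldl_take_ordS f s (Ordinal kn); have := @foldl_take_ordS g s (Ordinal kn).
move=> /= -> ->; rewrite fg //=; congr g.
by apply: IH => s' j jk; apply: fg; exact: ltnW.
Qed.

Lemma take_enum_ord_all : take n (enum 'I_n) = enum 'I_n.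
Proof. by rewrite take_oversize ?size_enum_ord. Qed.

End FoldOrd.

(** * Lyapunov analysis of SoCK for a fixed mu *)

Section SoCKAnalysis.
Context {R : realType} {n1 n2 N1 N2 : nat}.
Variables (F : 'I_n1 -> 'rV[R]_N1 -> R) (G : 'I_n2 -> 'rV[R]_N2 -> 'rV[R]_N1).
Variables (L LF BF LG BG : R).
Hypotheses (n1_gt0 : (0 < n1)%N) (n2_gt0 : (0 < n2)%N)
  (N1_gt0 : (0 < N1)%N) (N2_gt0 : (0 < N2)%N).
Hypothesis dF : forall i u, differentiable (F i) u.
Hypothesis dG : forall j x, differentiable (G j) x.
Hypothesis smF : forall i, smooth_fun LF (F i).
Hypothesis bF : forall i, bounded_grad BF (F i).
Hypothesis smG : forall j, smooth_map LG (G j).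
Hypothesis bG : forall j, bounded_Jac BG (G j).
Hypothesis lipFG : forall i j x y,
  enorm (grad (F i) (Gavg G x) *m Jac (G j) x
         - grad (F i) (Gavg G y) *m Jac (G j) y) <= L * enorm (x - y).
Hypothesis convf : convex_function [set: 'rV[R]_N2] (fcomp F G).
Variables (h : 'rV[R]_N2 -> \bar R) (mu : R).
Hypotheses (mu_gt0 : 0 < mu) (mu_leL : mu <= L) (regh : prox_regular mu h).
Variable xs : 'rV[R]_N2.
Hypothesis xs_min : forall u, (objective F G h xs <= objective F G h u)%E.

Let c := Constants L LF BF LG BG.
Let f := fcomp F G.
Let L_gt0 : 0 < L. Proof. exact: lt_le_trans mu_leL. Qed.
Let L_ge0 : 0 <= L. Proof. exact: ltW. Qed.

(** Since [fine] sends infinite values to 0, this is meaningful only where h is finite; domain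
    membership therefore accompanies the estimates. *)
Definition gap (u : 'rV[R]_N2) : R := f u + fine (h u) - (f xs + fine (h xs)).
Local Notation dom u := (h u \is a fin_num).
Local Notation Q u := (dot (u - xs) (u - xs)).

Let df u : differentiable f u. Proof. exact: differentiable_fcomp. Qed.
Let smf : smooth_fun L f. Proof. exact: fcomp_smooth. Qed.

Lemma fcomp_convex (t : R) x y : 0 <= t <= 1 ->
  f (t *: x + (1 - t) *: y) <= t * f x + (1 - t) * f y.
Proof.
move=> /andP[t0 t1].
have t01 : Itv.spec (Itv.num_sem (R := R)) (Itv.Real `[0%Z, 1%Z]) t.
  by rewrite /= /Itv.num_sem /= num_real in_itv /= t0.
exact: (convf (Itv.mk t01) (in_setT x) (in_setT y)).
Qed.

Lemma objective_sconvex : sconvex mu (objective F G h).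
Proof.
have := @sconvexD _ _ mu 0 f h _ (pr_sconvex regh); rewrite add0r; apply.
by move=> t x y t01; rewrite !mul0r subr0; exact: fcomp_convex.
Qed.

Lemma dom_xs : dom xs.
Proof.
have [u uf] := pr_proper regh; have := xs_min u; rewrite /objective.
rewrite fin_numE (pr_ninfty regh) /=; move=> le_u; apply/negP => /eqP hx.
by move: le_u; rewrite hx addey // -(fineK uf) leye_eq.
Qed.

Lemma gap_growth u : dom u -> mu / 2 * Q u <= gap u.
Proof.
move=> hu; have := sconvex_growth objective_sconvex xs_min (u := u).
rewrite /objective !fin_numD /= dom_xs hu => /(_ isT isT).
by rewrite !fineD ?dom_xs //= /gap /f; lra.
Qed.

Lemma gap_ge0 u : dom u -> 0 <= gap u.
Proof.
move=> /gap_growth; apply: le_trans; rewrite mulr_ge0 ?dot_ge0 //.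
by rewrite divr_ge0 // ltW.
Qed.

Lemma dom_comb (t : R) x y : 0 <= t <= 1 -> dom x -> dom y ->
  dom (t *: x + (1 - t) *: y) /\
  fine (h (t *: x + (1 - t) *: y)) <= t * fine (h x) + (1 - t) * fine (h y).
Proof.
move=> t01 hx hy; have [h1 h2] := pr_sconvex regh t01 hx hy; split=> //.
apply: le_trans h2 _; rewrite gerBl.
by move/andP: t01 => [t0 t1]; rewrite !mulr_ge0 ?dot_ge0 ?subr_ge0 ?invr_ge0 // ltW.
Qed.

Lemma gap_comb (t : R) x y : 0 <= t <= 1 -> dom x -> dom y ->
  gap (t *: x + (1 - t) *: y) <= t * gap x + (1 - t) * gap y.
Proof.
move=> t01 hx hy; have [_ h2] := dom_comb t01 hx hy.
have := fcomp_convex x y t01; rewrite /gap; lra.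
Qed.

(** Linear coupling, for an arbitrary vector g in place of the gradient. The proximal inequality of
    y' is added to t times that of z' at [xs]; convexity of f is used at [xs], [xt] and y with
    weights t, t and 1 - 2t. The error is paired with the old z, not with z', so the pairing partner
    is independent of the draw behind g. *)
Lemma one_step (t : R) (g xt y z : 'rV[R]_N2) : 0 < t <= 2^-1 ->
  dom xt -> dom y -> dom z ->
  let x := t *: z + t *: xt + (1 - t - t) *: y in
  let z' := argmin (fun u => ((dot g u + (3 * t * L / 2) * enorm (u - z) ^+ 2)%R%:E + h u)%E) in
  let y' := argmin (fun u => ((dot g u + 3 * L / 2 * enorm (u - x) ^+ 2)%R%:E + h u)%E) in
  let e := g - grad f x in
  [/\ dom y', dom z' &
  gap y' + (3 * t ^+ 2 * L / 2 + t * mu / 2) * Q z' <=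
  t * gap xt + (1 - 2 * t) * gap y + 3 * t ^+ 2 * L / 2 * Q z
  + dot e e / (2 * L) + t * dot e (xs - z)].
Proof.
move=> /andP[t0 t12] hxt hy hz x z' y' e.
have k1 : 0 < 3 * t * L / 2 by rewrite divr_gt0 // !mulr_gt0.
have k2 : 0 < 3 * L / 2 by rewrite divr_gt0 // mulr_gt0.
have [hz' optz] := proxP g z (ltW mu_gt0) k1 regh.
have [hy' opty] := proxP g x (ltW mu_gt0) k2 regh.
rewrite -/z' -/y' in hz' optz hy' opty.
split=> //.
(* The competitor for y': it satisfies yh - x = t (z' - z), so its proximal
   penalty is exactly the one paid by z'. *)
pose yh := (2 * t) *: (2^-1 *: z' + (1 - 2^-1) *: xt) + (1 - 2 * t) *: y.
have half01 : 0 <= (2^-1 : R) <= 1 by lra.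
have t201 : 0 <= 2 * t <= 1 by lra.
have [hm hml] := dom_comb half01 hz' hxt.
have [hyh hyl] := dom_comb t201 hm hy.
have yhE : yh = t *: z' + t *: xt + (1 - t - t) *: y.
  by apply/rowP => i; rewrite !mxE; field.
have oz := optz xs dom_xs.
have oy := opty yh hyh.
have yhx : yh - x = t *: (z' - z).
  by rewrite yhE /x; apply/rowP => i; rewrite !mxE; ring.
rewrite yhx !dotZl !dotZr in oy.
have /ler_normlP[_ desc] := smooth_quadratic x y' L_ge0 df smf.
have cxs := convex_gradient x xs L_ge0 df smf convf.
have cxt := convex_gradient x xt L_ge0 df smf convf.
have cy := convex_gradient x y L_ge0 df smf convf.
(* The penalty 3L/2 on y' - x is spent in full: L by the descent inequality and L/2 by this one. *)
have yng := young_dot (- e) (y' - x) L_gt0.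
rewrite [dot (- e) (- e)]dotNl dotNr opprK in yng.
have nn : 0 <= (2 * (3 * L / 2) + mu) / 2 * dot (yh - y') (yh - y').
  by rewrite mulr_ge0 ?dot_ge0 // divr_ge0 // addr_ge0 ?(ltW mu_gt0) // mulr_ge0 // ltW.
have Qz' : Q z' = dot (xs - z') (xs - z') by rewrite -opprB dotNl dotNr opprK.
have Qz : Q z = dot (xs - z) (xs - z) by rewrite -opprB dotNl dotNr opprK.
have gyh : dot g yh = dot g x + t * (dot g z' - dot g z).
  by rewrite -[yh](subrK x) yhx dotDr dotZr dotBr addrC.
have xE w : dot w x = t * dot w z + t * dot w xt + (1 - t - t) * dot w y.
  by rewrite /x !dotDr !dotZr.
rewrite Qz Qz' /gap; clear Qz Qz' yhE yhx optz opty.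
move: oz oy desc cxs cxt cy yng nn hyl hml; rewrite -/yh -/f gyh.
have -> : dot (- e) (y' - x) = dot (grad f x) (y' - x) - (dot g y' - dot g x).
  by rewrite /e opprB dotBl (dotBr _ _ g).
have -> : dot e (xs - z) = dot g xs - dot g z - (dot (grad f x) xs - dot (grad f x) z).
  by rewrite /e dotBl !(dotBr _ _ g) (dotBr xs z).
rewrite (dotBr xs x (grad f x)) (dotBr xt x (grad f x)) (dotBr y x (grad f x)).
rewrite (dotBr y' x (grad f x)) (xE (grad f x)).
rewrite ![(2 * L)^-1 * _]mulrC [in (2 * L)^-1]mulrC.
move: (dot g xs) (dot g z) (dot g z') (dot g y') (dot g x) => gxs gz gz' gy' gx.
move: (dot (grad f x) xs) (dot (grad f x) z) (dot (grad f x) xt) (dot (grad f x) y) (dot (grad f x) y') => dxs dz dxt dy dy'.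
move: (dot (z' - z) _) (dot (y' - x) _) (dot (xs - z) _) (dot (xs - z') _) => a1 a2 a3 a4.
move: (dot (yh - y') _) (dot e e / _) (f x) (f xs) (f xt) (f y) (f y') => a5 a6 fx fxs fxt fy fy'.
move: (fine (h xs)) (fine (h xt)) (fine (h y)) (fine (h y')) (fine (h z')) => hxs hxt' hhy hhy' hhz'.
move: (fine (h yh)) (fine _) => hhyh hhm oz oy desc cxs cxt cy yng nn hyl hml.
have oz' := ler_wpM2l (ltW t0) oz.
have cxs' := ler_wpM2l (ltW t0) cxs.
have cxt' := ler_wpM2l (ltW t0) cxt.
have t2 : 0 <= 1 - t - t by lra.
have cy' := ler_wpM2l t2 cy.
have hml' := ler_wpM2l (ltW t0) hml.
lra.
Qed.

Let m := inner_len c mu.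
Let A := sizeA c mu.
Let B := sizeB c mu.
Let C := sizeC c mu.
Let t := tau c mu.
Let p := 3 * t ^+ 2 * L / 2.
Let q := t * mu / 2.

Lemma nceil_ge (x : R) : x <= (nceil x)%:R.
Proof.
rewrite /nceil; have [x0|x0] := lerP 0 x.
  have c0 : (0 <= Num.ceil x)%R by rewrite -(ler_int R) (le_trans x0) ?ceil_ge.
  by rewrite natr_absz ger0_norm // ceil_ge.
by rewrite (le_trans (ltW x0)).
Qed.

Lemma nceil_le (x : R) : 0 <= x -> (nceil x)%:R <= x + 1.
Proof.
move=> x0; rewrite /nceil.
have c0 : (0 <= Num.ceil x)%R by rewrite -(ler_int R) (le_trans x0) ?ceil_ge.
rewrite natr_absz ger0_norm //; have := ceilB1_lt x; rewrite intrB; lra.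
Qed.

Lemma pceil_gt0 (x : R) : (0 < pceil x)%N.
Proof. by rewrite /pceil leq_max. Qed.

Lemma pceil_ge (x : R) : x <= (pceil x)%:R.
Proof. by apply: (le_trans (nceil_ge x)); rewrite ler_nat /pceil leq_maxr. Qed.

Lemma pceil_le (x : R) : 0 <= x -> (pceil x)%:R <= x + 1.
Proof.
move=> x0; rewrite /pceil /maxn; case: ifP => _; first exact: nceil_le.
by rewrite lerDr.
Qed.

Let r := Num.sqrt (L / mu).

Let r_ge1 : 1 <= r.
Proof. by rewrite /r -[leLHS]sqrtr1 ler_wsqrtr // ler_pdivlMr // mul1r. Qed.

Let r2 : r ^+ 2 * mu = L.
Proof. by rewrite sqr_sqrtr ?divr_ge0 ?(ltW mu_gt0) // divfK ?gt_eqF. Qed.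

Let m_ge : r <= 2 * m%:R.
Proof. by have := nceil_ge (2^-1 * r); rewrite -/m; lra. Qed.

Lemma inner_len_le : m%:R <= 3 / 2 * r.
Proof.
have : m%:R <= 2^-1 * r + 1 by apply: (@nceil_le (2^-1 * r)); have := r_ge1; lra.
by have := r_ge1; lra.
Qed.

Lemma inner_len_gt0 : (0 < m)%N.
Proof. by rewrite -(ltr0n R); have := m_ge; have := r_ge1; lra. Qed.

Let mR_gt0 : 0 < (m%:R : R). Proof. by rewrite ltr0n inner_len_gt0. Qed.

Let tm : t * m%:R = 2^-1.
Proof. by rewrite /t /tau -/m invfM -mulrA mulVf ?mulr1 // gt_eqF. Qed.

Let t_gt0 : 0 < t.
Proof. by rewrite invr_gt0 mulr_gt0. Qed.

Let t_le : t <= 2^-1.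
Proof.
rewrite -tm -[leLHS]mulr1 ler_wpM2l ?(ltW t_gt0) //.
by rewrite ler1n inner_len_gt0.
Qed.

(** With [tr_ge], this says that t equals sqrt(mu/L) up to a factor in [1/3, 1]. The upper bound
    keeps t^2 L below mu, the lower one keeps mu/L below 3t. *)
Let tr_le1 : t * r <= 1.
Proof. by have := ler_wpM2l (ltW t_gt0) m_ge; move: tm; lra. Qed.

Let tr_ge : 1 <= 3 * (t * r).
Proof. by have := ler_wpM2l (ltW t_gt0) inner_len_le; move: tm; lra. Qed.

Let tL_le : t ^+ 2 * L <= mu.
Proof.
rewrite -r2 mulrA -exprMn -[leRHS]mul1r ler_wpM2r ?(ltW mu_gt0) //.
by rewrite expr_le1 // mulr_ge0 ?(ltW t_gt0) // (le_trans ler01 r_ge1).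
Qed.

Let mu_le : mu <= 3 * (t * L).
Proof.
have h1 : 1 <= 3 * (t * r ^+ 2).
  apply: (le_trans tr_ge); rewrite !ler_pM2l // expr2.
  by rewrite ler_peMr // (le_trans ler01 r_ge1).
have := ler_wpM2r (ltW mu_gt0) h1; rewrite -r2; lra.
Qed.

Let A_gt0 : (0 < A)%N. Proof. exact: pceil_gt0. Qed.
Let B_gt0 : (0 < B)%N. Proof. exact: pceil_gt0. Qed.
Let C_gt0 : (0 < C)%N. Proof. exact: pceil_gt0. Qed.

Let batch (a K K' : R) : 0 < a ->
  K * K' / (pceil (a * K * K' / mu ^+ 2))%:R <= mu ^+ 2 / a.
Proof.
move=> a0; have := pceil_ge (a * K * K' / mu ^+ 2).
have := pceil_gt0 (a * K * K' / mu ^+ 2); move: (pceil _) => n n0.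
rewrite ler_pdivrMr ?exprn_gt0 // => h1.
by rewrite ler_pdivrMr ?ltr0n // mulrAC ler_pdivlMr // mulrC [mu ^+ 2 * _]mulrC mulrA.
Qed.

(** The batch constants enter as 3 (1/2160 + 1/2160 + 1/1080) = 1/180. *)
Lemma estimator_error x xt :
  avg (fun w => dot (@grad_est R n1 n2 N1 N2 F G A B C x xt w - grad f x)
                    (@grad_est R n1 n2 N1 N2 F G A B C x xt w - grad f x))
  <= mu ^+ 2 / 180 * dot (x - xt) (x - xt).
Proof.
have := grad_est_variance n1_gt0 n2_gt0 N2_gt0 dF dG smF bF smG bG lipFG
  A_gt0 B_gt0 C_gt0 x xt N1_gt0.
move/le_trans; apply; rewrite ler_wpM2r ?dot_ge0 //.
have hA : BG ^+ 4 * LF ^+ 2 / A%:R <= mu ^+ 2 / 2160.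
  by apply: (batch (BG ^+ 4) (LF ^+ 2)); rewrite ltr0n.
have hB : BF ^+ 2 * LG ^+ 2 / B%:R <= mu ^+ 2 / 2160.
  by apply: (batch (BF ^+ 2) (LG ^+ 2)); rewrite ltr0n.
have hC : L ^+ 2 / C%:R <= mu ^+ 2 / 1080.
  have : 0 < 1080 :> R by rewrite ltr0n.
  by move/(batch (L ^+ 2) 1); rewrite !mulr1.
lra.
Qed.

Let draws_gt0 : (0 < #|@draws n1 n2 A B C|)%N.
Proof. by rewrite !card_prod !muln_gt0 !card_ffun !card_ord !expn_gt0 n1_gt0 n2_gt0. Qed.

(** x - xt combines z - xt and y - xt with weights t and 1 - 2t, whose sum is at most 1. Convexity
    of the square applies, and each distance is then split at [xs]. *)
Lemma step_dist (x y z xt : 'rV[R]_N2) :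
  x = t *: z + t *: xt + (1 - t - t) *: y ->
  dot (x - xt) (x - xt) <= 2 * t * Q z + 2 * (1 - 2 * t) * Q y + 2 * Q xt.
Proof.
move=> ->; pose P := z - xs; pose W := y - xs; pose S := xt - xs.
have -> : t *: z + t *: xt + (1 - t - t) *: y - xt = t *: (P - S) + (1 - 2 * t) *: (W - S).
  by apply/rowP => i; rewrite !mxE; ring.
rewrite -/P -/W -/S.
have h1 := dot_sqrD2 P (- S); have h2 := dot_sqrD2 W (- S).
have h3 := dot_ge0 (P - S); have h4 := dot_ge0 (W - S).
have h5 := dot_ge0 ((P - S) - (W - S)).
rewrite [dot (- S) (- S)]dotNl dotNr opprK in h1 h2.
rewrite (dotBl (P - S)) !(dotBr _ (W - S)) (dotC (W - S) (P - S)) in h5.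
rewrite (dotDl (t *: _)) !(dotDr (t *: _)) !dotZl !dotZr (dotC (W - S) (P - S)).
have t2 : 0 <= 1 - 2 * t by have := t_le; lra.
have h6 := mulr_ge0 (mulr_ge0 (ltW t_gt0) t2) h5.
have h7 := mulr_ge0 (sqr_ge0 t) h3.
have h8 := mulr_ge0 (mulr_ge0 (ltW t_gt0) t2) h4.
have h9 := ler_wpM2l (ltW t_gt0) h1.
have h10 := ler_wpM2l t2 h2.
have h11 := mulr_ge0 (ltW t_gt0) (dot_ge0 S).
move: h6 h7 h8 h9 h10 h11.
move: (dot (P - S) (P - S)) (dot (W - S) (W - S)) (dot (P - S) (W - S)) => a1 a2 a3.
move: (dot P P) (dot W W) (dot S S) => a4 a5 a6; lra.
Qed.

Let stepW xt (w : @draws n1 n2 A B C) st := @SoCK_step R n1 n2 N1 N2 F G c mu h xt w st.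

Lemma SoCK_step_decrease (xt : 'rV[R]_N2) (st : @state R N2) :
  dom xt -> dom (st_y st) -> dom (st_z st) ->
  (forall w, dom (st_y (stepW xt w st))
             /\ dom (st_z (stepW xt w st))) /\
  avg (fun w : @draws n1 n2 A B C => gap (st_y (stepW xt w st))
         + (p + q) * Q (st_z (stepW xt w st))) <=
  13 / 12 * t * gap xt + (1 - 23 / 12 * t) * gap (st_y st)
    + (p + q / 3) * Q (st_z st).
Proof.
move=> hxt hy hz; set y := st_y st in hy *; set z := st_z st in hz *.
pose x := t *: z + t *: xt + (1 - t - t) *: y.
pose g w := @grad_est R n1 n2 N1 N2 F G A B C x xt w.
have tb : 0 < t <= 2^-1 by rewrite t_gt0 t_le.
have kE : 3 * t * L / 2 = (2 * alpha c mu)^-1.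
  by rewrite /alpha -/t /= invfM invrK; field.
have os w := one_step (g w) tb hxt hy hz.
have stepE w : st_y (stepW xt w st) = argmin (fun u =>
     ((dot (g w) u + 3 * L / 2 * enorm (u - x) ^+ 2)%R%:E + h u)%E) /\
   st_z (stepW xt w st) = argmin (fun u =>
     ((dot (g w) u + (3 * t * L / 2) * enorm (u - z) ^+ 2)%R%:E + h u)%E).
  by rewrite kE; case: w => -[wA wB] wC.
split=> [w|].
  by have [-> ->] := stepE w; have [] := os w.
pose e w := g w - grad f x.
(* Young's inequality with weight mu/4 on the biased term t <e, xs - z>: it costs t mu/8 on [Q z]
   and 2t/mu on |e|^2. *)
have pw w : gap (st_y (stepW xt w st))
         + (p + q) * Q (st_z (stepW xt w st)) <=
   (t * gap xt + (1 - 2 * t) * gap y + (p + t * mu / 8) * Q z)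
   + ((2 * L)^-1 + 2 * t / mu) * dot (e w) (e w).
  have [-> ->] := stepE w; have [_ _ h1] := os w.
  apply: (le_trans h1); rewrite -/x -/(e w).
  have mu4 : 0 < mu / 4 by rewrite divr_gt0.
  have := young_dot (e w) (xs - z) mu4.
  have -> : dot (xs - z) (xs - z) = Q z by rewrite -opprB dotNl dotNr opprK.
  have -> : (2 * (mu / 4))^-1 = 2 / mu by field; rewrite gt_eqF.
  move=> /(ler_wpM2l (ltW t_gt0)); rewrite /p [_ / (2 * L)]mulrC.
  move: (mu^-1) => i; lra.
apply: (le_trans (avg_le pw)); rewrite avgD avgZ avg_cst //.
have := estimator_error x xt; rewrite -/(g _) => err.
have co : 0 <= (2 * L)^-1 + 2 * t / mu.
  by rewrite addr_ge0 ?invr_ge0 ?mulr_ge0 ?invr_ge0 ?(ltW t_gt0) ?(ltW mu_gt0).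
have err' := ler_wpM2l co err.
(* In units of t mu/360: the first term gives 3, by mu/L <= 3t, and the second gives 4. *)
have coE : ((2 * L)^-1 + 2 * t / mu) * (mu ^+ 2 / 180) <= 7 / 360 * (t * mu).
  have -> : ((2 * L)^-1 + 2 * t / mu) * (mu ^+ 2 / 180) =
     mu * (mu / L) / 360 + t * mu / 90 by field; rewrite !gt_eqF.
  have : mu / L <= 3 * t by rewrite ler_pdivrMr // -mulrA.
  by move=> /(ler_wpM2l (ltW mu_gt0)); lra.
have dist := @step_dist x y z xt (erefl _).
have gy := gap_growth hy; have gxt := gap_growth hxt.
have tmu : 0 < t * mu by rewrite mulr_gt0.
have dx0 := dot_ge0 (x - xt).
have err2 := ler_wpM2r dx0 coE.
have tmu7 : 0 <= 7 / 360 * (t * mu) by rewrite mulr_ge0 // ltW.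
have err3 := ler_wpM2l tmu7 dist.
have t2 : 0 <= 1 - 2 * t by have := t_le; lra.
have gy' := ler_wpM2l (ltW t_gt0) gy.
have gy2 : t * (1 - 2 * t) * gap y <= t * gap y.
  rewrite ler_wpM2r ?gap_ge0 // ler_piMr ?(ltW t_gt0) //; have := t_gt0; lra.
have gy3 := ler_wpM2l (mulr_ge0 (ltW t_gt0) t2) gy.
have gxt' := ler_wpM2l (ltW t_gt0) gxt.
have tz : t * mu * (t * Q z) <= t * mu * (2^-1 * Q z).
  by rewrite ler_pM2l // ler_wpM2r ?dot_ge0.
have gxt0 := mulr_ge0 (ltW t_gt0) (gap_ge0 hxt).
have gy0 := mulr_ge0 (ltW t_gt0) (gap_ge0 hy).
have qz0 := mulr_ge0 (ltW tmu) (dot_ge0 (z - xs)).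
have fin : ((2 * L)^-1 + 2 * t / mu) * avg (fun w => dot (e w) (e w)) <=
    7 / 360 * (t * mu) * (2 * t * Q z + 2 * (1 - 2 * t) * Q y + 2 * Q xt).
  by apply: (le_trans err'); apply: le_trans err3; rewrite mulrA.
(* By mu Q <= 2 gap the error adds at most 7/90 t <= t/12 to the coefficients of the gaps at xt and
   y, turning 1 and -2 into 13/12 and -23/12. On [Q z], t <= 1/2 gives (1/8 + 7/360) t mu <= t mu/6
   = q/3. *)
move: fin gy' gy2 gy3 gxt' tz gxt0 gy0 qz0; rewrite /q.
move: (_ * avg _) => b; move: p (gap y) (gap xt) (Q z) (Q y) (Q xt) => p' g1 g2 q1 q2 q3.
move=> *; lra.
Qed.

Let Win := {ffun 'I_m -> @draws n1 n2 A B C}.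
Let run xt (w : Win) st k := @inner_state R n1 n2 N1 N2 F G c mu h xt w st k.
Let th := theta c mu.
Let sigma := \sum_(j < m) th ^+ j.
Let outer xst (w : Win) := @SoCK_outer R n1 n2 N1 N2 F G c mu h xst w.
Let domst (st : @state R N2) : Prop := dom (st_y st) /\ dom (st_z st).

Let Win_gt0 : (0 < #|{: Win}|)%N. Proof. exact: card_ffun_gt0. Qed.

Let p_ge0 : 0 <= p.
Proof. by rewrite /p divr_ge0 // mulr_ge0 // mulr_ge0 // sqr_ge0. Qed.

Let q_ge0 : 0 <= q.
Proof. by rewrite /q divr_ge0 // mulr_ge0 // ltW. Qed.

Let pq_ge0 : 0 <= p + q / 3.
Proof. by apply: addr_ge0; [exact: p_ge0|exact: divr_ge0]. Qed.

Let thE : th = 1 + t / 6.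
Proof.
rewrite /th /theta -/m /t /tau -/m -invfM; congr (1 + _^-1).
ring.
Qed.

Let stepW_dom xt w st : dom xt -> domst st -> domst (stepW xt w st).
Proof. by move=> hxt [hy hz]; have [/(_ w) hw _] := SoCK_step_decrease hxt hy hz. Qed.

Let run_dom xt (w : Win) st k : dom xt -> domst st -> domst (run xt w st k).
Proof.
move=> hxt; rewrite /run /inner_state; elim: (take _ _) st => [//|j l IH] st hst /=.
exact/IH/stepW_dom.
Qed.

Let runS xt (w : Win) st (k : 'I_m) :
  run xt w st k.+1 = stepW xt (w k) (run xt w st k).
Proof. exact: (foldl_take_ordS (fun s j => stepW xt (w j) s)). Qed.

Let run_upd xt (w : Win) st (k : 'I_m) v :
  run xt (@updf _ (fun _ => @draws n1 n2 A B C) k w v) st k = run xt w st k.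
Proof.
apply: (@eq_foldl_take _ _ (fun s j => stepW xt _ s) (fun s j => stepW xt _ s)) => s j jk.
by rewrite (@updf_neq _ (fun _ => @draws n1 n2 A B C)) //; apply: contraTneq jk => ->; rewrite ltnn.
Qed.

Let Ey xt st j := avg (fun w => gap (st_y (run xt w st j))).
Let Ez xt st j := avg (fun w => Q (st_z (run xt w st j))).

Lemma inner_decrease (xt : 'rV[R]_N2) st : dom xt -> domst st ->
  7 / 4 * t * (\sum_(j < m) th ^+ j * Ey xt st j.+1)
    + th ^+ m * ((1 - 23 / 12 * t) * Ey xt st m + (p + q / 3) * Ez xt st m) <=
  13 / 12 * t * gap xt * sigma
    + (1 - 23 / 12 * t) * gap (st_y st) + (p + q / 3) * Q (st_z st).
Proof.
move=> hxt hst; set E := Ey xt st; set V := Ez xt st.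
have run0 w : run xt w st 0 = st by rewrite /run /inner_state take0.
have E0 : E 0%N = gap (st_y st).
  rewrite /E /Ey (eq_avg (Y := fun _ => gap (st_y st))) ?avg_cst // => w.
  by rewrite run0.
have V0 : V 0%N = Q (st_z st).
  rewrite /V /Ez (eq_avg (Y := fun _ => Q (st_z st))) ?avg_cst // => w.
  by rewrite run0.
rewrite -E0 -V0 /sigma thE; apply: weighted_telescope.
- by rewrite t_gt0 t_le.
- exact: p_ge0.
- exact: q_ge0.
- have := ler_wpM2l (ltW t_gt0) tL_le; rewrite /p /q; lra.
- move=> j; rewrite /E /Ey /avg mulr_ge0 ?invr_ge0 ?ler0n // sumr_ge0 // => w _.
  by apply: gap_ge0; have [] := run_dom w j hxt hst.
- move=> j; rewrite /V /Ez /avg mulr_ge0 ?invr_ge0 ?ler0n // sumr_ge0 // => w _.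
  exact: dot_ge0.
move=> j jm; pose k := Ordinal jm.
pose X st' v := gap (st_y (stepW xt v st')) + (p + q) * Q (st_z (stepW xt v st')).
have -> : E j.+1 + (p + q) * V j.+1 = avg (fun w : Win => X (run xt w st k) (w k)).
  by rewrite /E /V /Ey /Ez -avgZ -avgD; apply: eq_avg => w; rewrite /X -runS.
(* The state before step k ignores draw k, so the one-step bound holds conditionally on that state
   and can be averaged. *)
rewrite (@avg_resample _ _ _ k (fun w v => X (run xt w st k) v)) //; last first.
  by move=> w v u; rewrite run_upd.
have -> : 13 / 12 * t * gap xt + (1 - 23 / 12 * t) * E j + (p + q / 3) * V j =
  avg (fun w : Win => 13 / 12 * t * gap xt + (1 - 23 / 12 * t) * gap (st_y (run xt w st k))
    + (p + q / 3) * Q (st_z (run xt w st k))).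
  by rewrite !avgD !avgZ avg_cst.
apply: avg_le => w; have [hy hz] := run_dom w k hxt hst.
by have [_] := SoCK_step_decrease hxt hy hz.
Qed.

Lemma gap_jensen (n : nat) (w : 'I_n -> R) (y : 'I_n -> 'rV[R]_N2) :
  (0 < n)%N -> (forall j, 0 < w j) -> (forall j, dom (y j)) ->
  dom ((\sum_j w j)^-1 *: (\sum_j w j *: y j)) /\
  (\sum_j w j) * gap ((\sum_j w j)^-1 *: (\sum_j w j *: y j)) <= \sum_j w j * gap (y j).
Proof.
case: n w y => // n w y _; elim: n w y => [|n IH] w y w0 hy.
  rewrite !big_ord_recl !big_ord0 !addr0 scalerA mulVf ?scale1r ?gt_eqF //.
have {IH} := IH (fun j => w (widen_ord (leqnSn _) j)) (fun j => y (widen_ord (leqnSn _) j)).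
rewrite !(big_ord_recr n.+1) /=.
move=> /(_ (fun j => w0 _) (fun j => hy _)).
set s := \sum_(i < n.+1) _; set b := w ord_max; set yl := y ord_max.
have s0 : 0 < s.
  rewrite /s big_ord_recl ltr_wpDr //; apply: sumr_ge0 => j _; exact: ltW.
have b0 : 0 < b by exact: w0.
set v := \sum_(i < n.+1) _ *: _ => -[hd hg].
have sb0 : s + b != 0 by rewrite gt_eqF // addr_gt0.
have -> : (s + b)^-1 *: (v + b *: yl) =
    (s / (s + b)) *: (s^-1 *: v) + (1 - s / (s + b)) *: yl.
  rewrite scalerDr !scalerA; congr (_ *: _ + _ *: _).
    by field; rewrite sb0 gt_eqF.
  by field.
have l01 : 0 <= s / (s + b) <= 1.
  by rewrite divr_ge0 ?addr_ge0 ?(ltW s0) ?(ltW b0) //= ler_pdivrMr ?mul1r ?addr_gt0 // lerDl ltW.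
split; first by have [] := dom_comb l01 hd (hy ord_max).
have := gap_comb l01 hd (hy ord_max); rewrite -/yl => gc.
have := ler_wpM2l (ltW (addr_gt0 s0 b0)) gc.
have -> : (s + b) * (s / (s + b) * gap (s^-1 *: v) + (1 - s / (s + b)) * gap yl) =
   s * gap (s^-1 *: v) + b * gap yl by field.
move/le_trans; apply; by rewrite lerD2r.
Qed.

(** This is the right side of [inner_decrease]. The left side dominates 13/12 times its new value:
    7/4 >= (13/12)^2 for the snapshot, and theta^m >= 13/12 for the rest. *)
Let Phi (xst : 'rV[R]_N2 * @state R N2) : R :=
  13 / 12 * t * sigma * gap xst.1 + (1 - 23 / 12 * t) * gap (st_y xst.2)
  + (p + q / 3) * Q (st_z xst.2).

Let th_gt0 : 0 < th. Proof. by rewrite thE; have := t_gt0; lra. Qed.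

Let domx (xst : 'rV[R]_N2 * @state R N2) : Prop := dom xst.1 /\ domst xst.2.

Let outer_dom xst w : domx xst -> domx (outer xst w).
Proof.
case: xst => xt st [hxt hst]; rewrite /outer /SoCK_outer /=; split => /=.
  have [] := @gap_jensen m (fun j => th ^+ j)
    (fun j => st_y (run xt w (Defs.charge (n2 + n2 + n1) st) j.+1)) inner_len_gt0 => // j.
    exact: exprn_gt0.
  by have [] := @run_dom xt w (Defs.charge (n2 + n2 + n1) st) j.+1 hxt hst.
exact: (@run_dom xt w (Defs.charge (n2 + n2 + n1) st) m hxt hst).
Qed.

Lemma outer_decrease xst : domx xst ->
  avg (fun w => Phi (outer xst w)) <= 12 / 13 * Phi xst.
Proof.
case: xst => xt st hx; have hxt : dom xt := hx.1; have hst : domst st := hx.2; pose st' := Defs.charge (n2 + n2 + n1) st.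
have hst' : domst st' by [].
have := inner_decrease hxt hst'; set E := Ey xt st'; set V := Ez xt st'.
have Em0 : 0 <= E m.
  rewrite /E /Ey /avg mulr_ge0 ?invr_ge0 ?ler0n // sumr_ge0 // => w _.
  by apply: gap_ge0; have [] := run_dom w m hxt hst'.
have Vm0 : 0 <= V m.
  by rewrite /V /Ez /avg mulr_ge0 ?invr_ge0 ?ler0n // sumr_ge0 // => w _; exact: dot_ge0.
have thm : 13 / 12 <= th ^+ m.
  have := @theta_pow_ge R m m inner_len_gt0.
  apply: le_trans; have -> : m%:R / (12 * m%:R) = 12^-1 :> R by field; rewrite gt_eqF.
  lra.
have pq := pq_ge0.
have ct : 0 <= 1 - 23 / 12 * t by have := t_le; lra.
have jens : sigma * avg (fun w => gap (outer (xt, st) w).1) <= \sum_(j < m) th ^+ j * E j.+1.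
  rewrite /E /Ey -avgZ; under [leRHS]eq_bigr do rewrite -avgZ.
  rewrite -avg_sum; apply: avg_le => w.
  have [j|j|_] := @gap_jensen m (fun j => th ^+ j) (fun j => st_y (run xt w st' j.+1)) inner_len_gt0.
  - exact: exprn_gt0.
  - by have [] := run_dom w j.+1 hxt hst'.
  - by [].
have avgPhi : avg (fun w => Phi (outer (xt, st) w)) =
   13 / 12 * t * (sigma * avg (fun w => gap (outer (xt, st) w).1))
   + (1 - 23 / 12 * t) * E m + (p + q / 3) * V m.
  rewrite [in RHS]mulrA; exact: (avg_lin3 _ _ _ (fun w => gap (outer (xt, st) w).1)
    (fun w => gap (st_y (run xt w st' m))) (fun w => Q (st_z (run xt w st' m)))).
rewrite avgPhi.
have -> : Phi (xt, st) = 13 / 12 * t * sigma * gap xt + (1 - 23 / 12 * t) * gap (st_y st)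
  + (p + q / 3) * Q (st_z st) by [].
have sg0 : 0 <= sigma * avg (fun w => gap (outer (xt, st) w).1).
  rewrite mulr_ge0 //; first by apply: sumr_ge0 => j _; rewrite exprn_ge0 // ltW.
  rewrite /avg mulr_ge0 ?invr_ge0 ?ler0n // sumr_ge0 // => w _.
  by apply: gap_ge0; have [] := outer_dom w hx.
have tj := ler_wpM2l (ltW t_gt0) jens.
have tsg := mulr_ge0 (ltW t_gt0) sg0.
have rest : 13 / 12 * ((1 - 23 / 12 * t) * E m + (p + q / 3) * V m) <=
   th ^+ m * ((1 - 23 / 12 * t) * E m + (p + q / 3) * V m).
  by rewrite ler_wpM2r // addr_ge0 // mulr_ge0.
move: tj tsg rest.
move: (_ * avg _) => a; move: (\sum_(_ < _) _ * E _) => b.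
move: ((1 - 23 / 12 * t) * E m) ((p + q / 3) * V m) => e1 v1.
move: ((1 - 23 / 12 * t) * gap _) ((p + q / 3) * Q _) => e2 v2.
move: (th ^+ m * _) => x1; move: sigma (gap xt) => s g *; lra.
Qed.

Variable S : nat.
Let SW := @SoCK_space R n1 n2 c mu S.
Let outers (w : SW) xst k := foldl (fun xst s => outer xst (w s)) xst (take k (enum 'I_S)).

Let outers_dom w xst k : domx xst -> domx (outers w xst k).
Proof.
rewrite /outers; elim: (take _ _) xst => [//|j l IH] xst hst /=.
exact/IH/outer_dom.
Qed.

Let outers_upd (w : SW) xst (o : 'I_S) v :
  outers (@updf _ (fun _ => Win) o w v) xst o = outers w xst o.
Proof.
apply: eq_foldl_take => s j jk.
by rewrite (@updf_neq _ (fun _ => Win)) //; apply: contraTneq jk => ->; rewrite ltnn.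
Qed.

Let outers_decrease xst k : domx xst -> (k <= S)%N ->
  avg (fun w => Phi (outers w xst k)) <= (12 / 13) ^+ k * Phi xst.
Proof.
move=> hx; elim: k => [|k IH] kS.
  rewrite expr0 mul1r (eq_avg (Y := fun _ => Phi xst)); last first.
    by move=> w; rewrite /outers take0.
  by rewrite avg_cst //; exact: card_ffun_gt0.
have := IH (ltnW kS); pose o := Ordinal kS.
rewrite exprS -mulrA => /(ler_wpM2l (_ : 0 <= 12 / 13)) h1.
apply: le_trans (h1 _); last by lra.
have -> : avg (fun w => Phi (outers w xst k.+1)) =
   avg (fun w : SW => Phi (outer (outers w xst o) (w o))).
  by apply: eq_avg => w; rewrite /outers (foldl_take_ordS _ _ o).
rewrite (@avg_resample _ _ _ o (fun w v => Phi (outer (outers w xst o) v))) //; last first.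
  by move=> w v u; rewrite outers_upd.
rewrite -avgZ; apply: avg_le => w; apply: outer_decrease; exact: outers_dom.
Qed.

(** Since t sigma lies in [1/2, 1], [Phi] is at most 73/12 of the gap at the start and at least
    13/24 of the gap of the snapshot at the end. The ratio 146/13 of these constants is below 12. *)
Theorem SoCK_decrease x0 : dom x0 ->
  (forall w, dom (@SoCK R n1 n2 N1 N2 F G c mu h S x0 w).1) /\
  avg (fun w => gap (@SoCK R n1 n2 N1 N2 F G c mu h S x0 w).1) <=
  12 * (12 / 13) ^+ S * gap x0.
Proof.
move=> hx; pose xst := (x0, State x0 x0 0).
have hxst : domx xst by [].
have SE w : (@SoCK R n1 n2 N1 N2 F G c mu h S x0 w).1 = (outers w xst S).1.
  by rewrite /outers take_enum_ord_all /SoCK; case: (foldl _ _ _).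
split=> [w|]; first by rewrite SE; have [] := outers_dom w S hxst.
rewrite (eq_avg (fun w => congr1 gap (SE w))).
have D0 := gap_ge0 hx; have D1 := gap_growth hx.
have ct : 0 <= 1 - 23 / 12 * t by have := t_le; lra.
have pq := pq_ge0.
have ts_ge : 2^-1 <= t * sigma.
  rewrite -tm ler_pM2l //.
  have -> : m%:R = \sum_(j < m) (1 : R) by rewrite sumr_const card_ord.
  by apply: ler_sum => j _; rewrite exprn_ege1 // thE; have := t_gt0; lra.
have ts_le : t * sigma <= 1.
  apply: (@le_trans _ _ (t * (2 * m%:R))); last by move: tm; lra.
  rewrite ler_pM2l //.
  have -> : 2 * m%:R = \sum_(j < m) (2 : R) by rewrite sumr_const card_ord mulr_natr.
  apply: ler_sum => j _.
  apply: (le_trans (@theta_pow_le R m j (ltnW (ltn_ord j)) inner_len_gt0)).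
  have : (j%:R : R) / (12 * m%:R) <= 1.
    rewrite ler_pdivrMr ?mulr_gt0 // mul1r.
    have : (j%:R : R) <= m%:R by rewrite ler_nat ltnW.
    have := mR_gt0; lra.
  rewrite -mulrA; have jj : 2 * (j%:R / (12 * m%:R)) <= (2 * m%:R) / (12 * m%:R) :> R.
    rewrite mulrA ler_pM2r ?invr_gt0 ?mulr_gt0 // ler_pM2l // ler_nat ltnW //.
  move=> _; apply: (@le_trans _ _ (1 + 2 * m%:R / (12 * m%:R))); first by rewrite lerD2l.
  by rewrite -mulf_div mulfV ?gt_eqF // mulr1; lra.
have Phi0 : Phi xst <= 73 / 12 * gap x0.
  rewrite /Phi /=.
  have h1 : t * sigma * gap x0 <= 1 * gap x0 by rewrite ler_wpM2r.
  have h2 : (1 - 23 / 12 * t) * gap x0 <= 1 * gap x0.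
    by rewrite ler_wpM2r // lerBlDr lerDl mulr_ge0 // ltW.
  have pqm : p + q / 3 <= 2 * mu.
    have h3 : t * mu <= 2^-1 * mu by rewrite ler_pM2r.
    by have := mu_gt0; move: tL_le; rewrite /p /q; lra.
  have h4 : (p + q / 3) * Q x0 <= 2 * mu * Q x0 by rewrite ler_wpM2r ?dot_ge0.
  move: h1 h2 h4 D1; rewrite -!mulrA; move: (_ * Q x0) => *; lra.
have PhiS : 13 / 24 * avg (fun w => gap (outers w xst S).1) <=
    avg (fun w => Phi (outers w xst S)).
  rewrite -avgZ; apply: avg_le => w; have [hx1 [hy1 hz1]] := outers_dom w S hxst.
  have g1 := gap_ge0 hx1; have g2 := gap_ge0 hy1.
  have h1 : 2^-1 * gap (outers w xst S).1 <= t * sigma * gap (outers w xst S).1.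
    by rewrite ler_wpM2r.
  have h2 := mulr_ge0 ct g2; have h3 := mulr_ge0 pq (dot_ge0 (st_z (outers w xst S).2 - xs)).
  rewrite /Phi; move: h1 h2 h3; move: (_ * Q _) (_ * gap (st_y _)) => b1 b2; lra.
have := outers_decrease hxst (leqnn S).
have r0 : 0 <= (12 / 13 : R) ^+ S by rewrite exprn_ge0 //; lra.
have h5 := ler_wpM2l r0 Phi0.
have h6 := mulr_ge0 r0 D0.
move: PhiS h5 h6; move: (avg _) (avg _) (_ ^+ S) => a1 a2 rr *; nra.
Qed.

End SoCKAnalysis.

(** * NoCK *)

Lemma continuous_scaled_sqr_dist (R : realType) n (k : R) (z : 'rV[R]_n) :
  continuous (fun u : 'rV[R]_n => k * dot (u - z) (u - z)).
Proof.
move=> u; have h1 : {for u, continuous (cst k : 'rV[R]_n -> R)} by exact: cst_continuous.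
have h2 : {for u, continuous (fun v : 'rV[R]_n => dot (v - z) (v - z))}.
  exact: continuous_sqr_dist.
have h3 := continuousM h1 h2; exact: h3.
Qed.

Section NoCKAnalysis.
Context {R : realType} {n1 n2 N1 N2 : nat}.
Variables (F : 'I_n1 -> 'rV[R]_N1 -> R) (G : 'I_n2 -> 'rV[R]_N2 -> 'rV[R]_N1).
Variables (h : 'rV[R]_N2 -> \bar R) (L LF BF LG BG : R).
Variables (xstar x0 : 'rV[R]_N2) (DH Dx eps : R).
Hypotheses (n1_gt0 : (0 < n1)%N) (n2_gt0 : (0 < n2)%N)
  (N1_gt0 : (0 < N1)%N) (N2_gt0 : (0 < N2)%N).
Hypothesis dF : forall i u, differentiable (F i) u.
Hypothesis dG : forall j x, differentiable (G j) x.
Hypothesis pcc : proper_closed_convex h.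
Hypothesis convf : convex_function [set: 'rV[R]_N2] (fcomp F G).
Hypothesis smF : forall i, smooth_fun LF (F i).
Hypothesis bF : forall i, bounded_grad BF (F i).
Hypothesis smG : forall j, smooth_map LG (G j).
Hypothesis bG : forall j, bounded_Jac BG (G j).
Hypothesis lipFG : forall i j x y,
  enorm (grad (F i) (Gavg G x) *m Jac (G j) x
         - grad (F i) (Gavg G y) *m Jac (G j) y) <= L * enorm (x - y).
Hypothesis xstar_min : forall x, (objective F G h xstar <= objective F G h x)%E.
Hypothesis Dx_bound : enorm (x0 - xstar) ^+ 2 <= Dx.
Hypotheses (DH_gt0 : 0 < DH) (Dx_gt0 : 0 < Dx).
Let c := Constants L LF BF LG BG.
Let mu0 := DH / Dx.
Hypothesis mu0_leL : mu0 <= L.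
Variable S : nat.
Hypothesis S_large : 12 * (12 / 13 : R) ^+ S <= 16^-1.
Let gam : R := 12 * (12 / 13) ^+ S.

Let f := fcomp F G.
Let mu t := NoCK_mu mu0 t.
Let ht t := NoCK_h h x0 mu0 t.
Local Notation dom u := (h u \is a fin_num).

Let hN x : h x != -oo%E. Proof. by case: pcc => -[]. Qed.

Let mu0_gt0 : 0 < mu0. Proof. exact: divr_gt0. Qed.

Let mu_gt0 t : 0 < mu t. Proof. by rewrite divr_gt0 // exprn_gt0. Qed.

Let mu_half t : mu t.+1 = mu t / 2.
Proof. by rewrite /mu /NoCK_mu exprSr invfM mulrA. Qed.

Let mu_leL t : mu t <= L.
Proof.
apply: le_trans mu0_leL; rewrite ler_pdivrMr ?exprn_gt0 //.
by rewrite ler_peMr ?(ltW mu0_gt0) // exprn_ege1 // ler1n.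
Qed.

Let df u : differentiable f u. Proof. exact: differentiable_fcomp. Qed.

Lemma dom_minimizer : dom xstar.
Proof.
have [[_ [u hu]] _ _] := pcc; have := xstar_min u; rewrite /objective.
have uf : h u \is a fin_num by rewrite fin_numE hN hu.
rewrite fin_numE hN /=; move=> le_u; apply/negP => /eqP hx.
by move: le_u; rewrite hx addey // -(fineK uf) leye_eq.
Qed.

(** No separation theorem is involved in the lower bound on h: h is at least the minimum of f + h
    minus f, and f grows at most linearly because its gradient is bounded by [BG * BF]. *)
Lemma prox_regular_h : prox_regular 0 h.
Proof.
have [[_ [u hu]] lh ch] := pcc.
split=> //; [exact: econvex_sconvex| |by exists u; rewrite fin_numE hN hu].
exists (f xstar + fine (h xstar) - f 0), (BG * BF) => v.
have fv : f v <= f 0 + BG * BF * enorm v.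
  have [s _] := mean_value_line 0 v df; rewrite subr0 add0r => e.
  have := dot_le_enorm (grad f (s *: v)) v; rewrite -e.
  have : enorm (grad f (s *: v)) * enorm v <= BG * BF * enorm v.
    by rewrite ler_wpM2r ?enorm_ge0 //; apply: grad_fcomp_bounded.
  lra.
have := xstar_min v; have := hN v; rewrite /objective -(fineK dom_minimizer).
case: (h v) => [b| |] // _; last by move=> _; rewrite leey.
rewrite !lee_fin /=; move: fv; rewrite /f; lra.
Qed.

Let htE t : ht t = fun u => ((mu t / 2 * dot (u - x0) (u - x0))%:E + h u)%E.
Proof. by apply/funext => u; rewrite /ht /NoCK_h sqr_enorm addeC. Qed.

Let ht_fin t u : (ht t u \is a fin_num) = dom u.
Proof. by rewrite htE fin_numD. Qed.

Let ht_fine t u : dom u ->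
  fine (ht t u) = fine (h u) + mu t / 2 * dot (u - x0) (u - x0).
Proof. by move=> hu; rewrite htE fineD //= addrC. Qed.

Lemma prox_regular_ht t : prox_regular (mu t) (ht t).
Proof.
have [sc lh _ [a [b low]] [u uf]] := prox_regular_h.
have mu2 : 0 <= mu t / 2 by rewrite divr_ge0 // ltW.
split.
- rewrite htE -[mu t]addr0; apply: sconvexD sc => s x y s01.
  have := sqr_dist_sconvex (mu t / 2) x0 s x y; rewrite addr0.
  by rewrite [2 * (_ / 2)]mulrC divfK.
- rewrite htE; apply: lower_semicontinuousD => // v.
  exact: continuous_scaled_sqr_dist.
- by move=> x; rewrite htE; case: (h x) (hN x).
- exists a, b => v; apply: (le_trans (low v)); rewrite htE leeDr //.
  by rewrite lee_fin mulr_ge0 ?dot_ge0.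
- by exists u; rewrite ht_fin.
Qed.

Lemma exists_minimizer t : exists z, forall u, (objective F G (ht t) z <= objective F G (ht t) u)%E.
Proof.
have regt := prox_regular_ht t.
apply: (@sconvex_min _ _ (mu t) (f xstar + fine (h xstar))) => //.
- exact: (objective_sconvex convf regt).
- apply: lower_semicontinuousD; last exact: pr_lsc regt.
  by move=> x; apply: differentiable_continuous.
- move=> u; rewrite EFinD fineK ?dom_minimizer //; apply: (le_trans (xstar_min u)).
  rewrite /objective htE leeD2l // leeDr // lee_fin mulr_ge0 ?dot_ge0 //.
  by rewrite divr_ge0 // ltW.
- by exists xstar; rewrite fin_numD /= ht_fin dom_minimizer.
Qed.

Let xt t := sval (cid (exists_minimizer t)).
Let xt_min t : forall u, (objective F G (ht t) (xt t) <= objective F G (ht t) u)%E.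
Proof. exact: (svalP (cid (exists_minimizer t))). Qed.

Let gapt t := gap F G (ht t) (xt t).

Let xt_dom t : dom (xt t).
Proof. by rewrite -(ht_fin t); exact: (dom_xs (prox_regular_ht t) (@xt_min t)). Qed.

Lemma NoCK_HminE t : NoCK_Hmin F G h x0 mu0 t = objective F G (ht t) (xt t).
Proof.
apply/eqP; rewrite eq_le; apply/andP; split.
  by apply: ereal_inf_lbound; exists (xt t).
by apply: le_ereal_inf_tmp => _ [u _ <-]; exact: xt_min.
Qed.

Lemma NoCK_gapE t u : dom u ->
  (NoCK_H F G h x0 mu0 t u - NoCK_Hmin F G h x0 mu0 t = (gapt t u)%:E)%E.
Proof.
move=> hu; rewrite NoCK_HminE /NoCK_H /objective -/(ht t).
have h1 : ht t u \is a fin_num by rewrite ht_fin.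
have h2 : ht t (xt t) \is a fin_num by rewrite ht_fin xt_dom.
by rewrite -{1}(fineK h1) -{1}(fineK h2).
Qed.

Variable T : nat.
Let Om : finType := @NoCK_space R n1 n2 c S mu0 T.
Let W (t : 'I_T) : finType := @SoCK_space R n1 n2 c (mu t) S.
Let it (t : nat) (w : Om) := NoCK_iter F G h x0 t w.
Let sock (t : nat) x (v : @SoCK_space R n1 n2 c (mu t) S) :=
  (@SoCK R n1 n2 N1 N2 F G c (mu t) (ht t) S x v).1.

Let sockP t x : dom x -> (forall v, dom (@sock t x v)) /\
  avg (fun v => gapt t (@sock t x v)) <= gam * gapt t x.
Proof.
rewrite -(ht_fin t) => hx.
have [h1 h2] := @SoCK_decrease R n1 n2 N1 N2 F G L LF BF LG BG n1_gt0 n2_gt0 N1_gt0 N2_gt0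
  dF dG smF bF smG bG lipFG convf (ht t) (mu t) (mu_gt0 t) (mu_leL t) (prox_regular_ht t)
  (xt t) (@xt_min t) S x hx.
by split; [move=> v; rewrite -(ht_fin t); exact: h1|exact: h2].
Qed.

Let itS (o : 'I_T) (w : Om) : it o.+1 w = @sock o (it o w) (w o).
Proof.
rewrite /it /NoCK_iter /NoCK_run (foldl_take_ordS _ _ o).
by case: (foldl _ _ _) => x k; rewrite /sock; case: (SoCK _ _ _ _ _).
Qed.

Let it_upd (o : 'I_T) (w : Om) (v : W o) :
  it o (@updf _ (fun t => W t) o w v) = it o w.
Proof.
rewrite /it /NoCK_iter /NoCK_run; congr fst; apply: eq_foldl_take => -[x k] j jo.
by rewrite (@updf_neq _ (fun t => W t)) //; apply: contraTneq jo => ->; rewrite ltnn.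
Qed.

Hypothesis x0_dom : dom x0.

Let it_dom t w : dom (it t w).
Proof.
rewrite /it /NoCK_iter /NoCK_run.
have : forall (l : seq 'I_T) xk, dom xk.1 -> dom (foldl (fun xk (i : 'I_T) =>
           let: (x, k) := xk in
           let: (x', k') := @SoCK R n1 n2 N1 N2 F G c (mu i) (ht i) S x (w i) in
           (x', k + k')%N) xk l).1.
  elim=> [|o l IH] [x k] hx //=; apply: IH.
  have [/(_ (w o)) + _] := sockP o hx; rewrite /sock.
  by case: (SoCK _ _ _ _ _).
by move=> /(_ _ (x0, 0%N)); apply.
Qed.

Let W_gt0 (o : 'I_T) : (0 < #|W o|)%N.
Proof.
apply/card_gt0P; exists [ffun=> [ffun=> (([ffun=> Ordinal n2_gt0], [ffun=> Ordinal n2_gt0]), [ffun=> Ordinal n1_gt0])]].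
by [].
Qed.

Let Om_gt0 : (0 < #|Om|)%N.
Proof.
have wit (o : 'I_T) : {v : W o | true} by exists (enum_val (Ordinal (W_gt0 o))).
by apply/card_gt0P; exists ([ffun o => sval (wit o)] : {dffun forall o : 'I_T, W o}).
Qed.

(** The event P stays free, subject to invariance under resampling round o. Fixing the value of the
    iterate before round o gives the conditional decrease; the full space gives the one in mean. *)
Let sum_step (o : 'I_T) (P : pred Om) :
  (forall w v, P (@updf _ (fun t => W t) o w v) = P w) ->
  \sum_(w | P w) gapt o (it o.+1 w) <= \sum_(w | P w) gam * gapt o (it o w).
Proof.
move=> Pupd.
have -> : \sum_(w | P w) gapt o (it o.+1 w) =
    \sum_(w | P w) (fun w v => gapt o (@sock o (it o w) v)) w (w o).
  by apply: eq_bigr => w _; rewrite itS.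
rewrite (@sum_resample R Om (W o) (fun w => w o) (fun w v => @updf _ (fun t => W t) o w v) P
  (fun w v => gapt o (@sock o (it o w) v))) //.
- by apply: ler_sum => w _; have [_] := sockP o (it_dom o w).
- by move=> w v; exact: (@updf_eq _ (fun t => W t)).
- by move=> w v; exact: (@updfK _ (fun t => W t)).
- by move=> w v u; rewrite it_upd.
Qed.

Let gapt_ge0 t x : dom x -> 0 <= gapt t x.
Proof.
rewrite -(ht_fin t) => hx.
exact: (gap_ge0 convf (mu_gt0 t) (prox_regular_ht t) (@xt_min t) hx).
Qed.

Lemma NoCK_requirementP : NoCK_requirement F G c h S x0 mu0 T.
Proof.
move=> t w tT; pose o := Ordinal tT.
rewrite (NoCK_gapE t (it_dom t w)) /cond_expect.
rewrite (eq_bigr (fun w' => (gapt t (it t.+1 w'))%:E)); last first.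
  by move=> w' _; rewrite (NoCK_gapE t (it_dom t.+1 w')).
rewrite sumEFin -!EFinM lee_fin.
pose P (w' : Om) := NoCK_iter F G h x0 t w' == NoCK_iter F G h x0 t w.
have Pupd w' v : P (@updf _ (fun t => W t) o w' v) = P w'.
  by rewrite /P -!/(it t _) (it_upd w' v).
have cP : (0 < #|[set w' : Om | P w']%SET|)%N.
  by apply/card_gt0P; exists w; rewrite inE; exact: eqxx.
rewrite ler_pdivrMl; last by rewrite ltr0n; exact: cP.
apply: (le_trans (@sum_step o P Pupd)).
rewrite (eq_bigr (fun _ => gam * gapt t (it t w))); last first.
  by move=> w' /eqP; rewrite -!/(it t _) => ->.
rewrite sumr_const -[X in X <= _]mulr_natl cardsE ler_wpM2l ?ler0n //.
rewrite ler_wpM2r ?gapt_ge0 ?it_dom //; move: S_large; rewrite /gam; lra.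
Qed.

Let X2 := dot (xstar - x0) (xstar - x0).
Let Hr u := f u + fine (h u).

Let X2_le : X2 <= Dx.
Proof. by rewrite /X2 -sqr_enorm enormB. Qed.

Let gaptE t u : dom u ->
  gapt t u = Hr u + mu t / 2 * dot (u - x0) (u - x0) - (f (xt t) + fine (ht t (xt t))).
Proof. by move=> hu; rewrite /gapt /gap ht_fine // /Hr addrA. Qed.

Let Hmin_le t u : dom u ->
  f (xt t) + fine (ht t (xt t)) <= Hr u + mu t / 2 * dot (u - x0) (u - x0).
Proof. by move=> hu; rewrite -subr_ge0 -gaptE // gapt_ge0. Qed.

Let Hr_min u : dom u -> Hr xstar <= Hr u.
Proof.
move=> hu; have := xstar_min u; rewrite /objective.
by rewrite -(fineK hu) -(fineK dom_minimizer) -!EFinD lee_fin.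
Qed.

Let Hmin_ge t : Hr xstar <= f (xt t) + fine (ht t (xt t)).
Proof.
rewrite ht_fine // addrA; apply: (le_trans (Hr_min (xt_dom t))).
by rewrite lerDl mulr_ge0 ?dot_ge0 // divr_ge0 // ltW.
Qed.

(** Halving mu lowers the objective pointwise. The minimum value can drop too, but the old one
    exceeds the unregularized minimum by at most mu_t Dx/2 and the new one stays above it. *)
Let gapt_succ t u : dom u -> gapt t.+1 u <= gapt t u + mu t / 2 * Dx.
Proof.
move=> hu; rewrite !gaptE // mu_half.
have h1 := Hmin_ge t.+1; have h2 := Hmin_le t dom_minimizer; rewrite -/X2 in h2.
have h3 : mu t / 2 * X2 <= mu t / 2 * Dx by rewrite ler_wpM2l // divr_ge0 // ltW.
have h4 := mulr_ge0 (ltW (mu_gt0 t)) (dot_ge0 (u - x0)).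
move: h1 h2 h3 h4; lra.
Qed.

Let muDx t : mu t * Dx = DH / 2 ^+ t.
Proof. by rewrite /mu /NoCK_mu /mu0 mulrAC divfK // gt_eqF. Qed.

Let avg_step t : (t < T)%N ->
  avg (fun w => gapt t (it t.+1 w)) <= gam * avg (fun w => gapt t (it t w)).
Proof.
move=> tT; rewrite -avgZ /avg ler_wpM2l ?invr_ge0 ?ler0n //.
exact: (@sum_step (Ordinal tT) xpredT).
Qed.

Let gam_le : gam <= 16^-1. Proof. exact: S_large. Qed.

Let gam_ge0 : 0 <= gam.
Proof. by rewrite mulr_ge0 // exprn_ge0 // divr_ge0. Qed.

Hypothesis gap0 : Hr x0 - Hr xstar <= DH.

Let avg_bound t : (t <= T)%N ->
  avg (fun w => gapt t (it t w)) <= 4 / 3 * (DH / 2 ^+ t).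
Proof.
elim: t => [|t IH] tT.
  rewrite expr0 divr1; apply: avg_le_cst => // w.
  rewrite /it /NoCK_iter /NoCK_run take0 /= gaptE // subrr dot0l mulr0 addr0.
  by have := Hmin_ge 0; move: gap0 DH_gt0; lra.
(* The constant a = 4/3 satisfies a/16 + 1/2 <= a/2: contraction followed by the change of
   regularizer reproduces the bound for the next round. *)
apply: (@le_trans _ _ (avg (fun w => gapt t (it t.+1 w) + mu t / 2 * Dx))).
  by apply: avg_le => w; apply: gapt_succ.
rewrite avgD avg_cst // [_ / 2 * _]mulrAC muDx exprS invfM.
have := avg_step tT.
have := ler_wpM2l gam_ge0 (IH (ltnW tT)).
have d0 : 0 <= DH / 2 ^+ t by rewrite divr_ge0 ?exprn_ge0 // ltW.
have := ler_wpM2r d0 gam_le.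
rewrite [DH * (_ * _)]mulrCA.
move: (DH / _) d0 => d d0; lra.
Qed.

(** Comparing minimum values directly would cost mu_t Dx/2, which at t = T - 1 is DH/2^T, the whole
    error budget. The midpoint argument lowers this to mu_t Dx/3 and doubles the gap instead, which
    the factor 1/16 can afford. *)
Let final_point t u : dom u -> Hr u - Hr xstar <= 2 * gapt t u + mu t / 3 * Dx.
Proof.
move=> hu; have half01 : 0 <= (2^-1 : R) <= 1 by lra.
have sc := objective_sconvex convf (prox_regular_ht t).
have fu : objective F G (ht t) u \is a fin_num by rewrite /objective fin_numD /= ht_fin.
have fs : objective F G (ht t) xstar \is a fin_num.
  by rewrite /objective fin_numD /= ht_fin dom_minimizer.
have [mf ml] := sc _ _ _ half01 fu fs.
have := @xt_min t (2^-1 *: u + (1 - 2^-1) *: xstar).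
have ff : objective F G (ht t) (xt t) \is a fin_num.
  by rewrite /objective fin_numD /= ht_fin.
rewrite -(fineK mf) -(fineK ff) lee_fin => h1.
have oE v : dom v -> fine (objective F G (ht t) v) = f v + fine (ht t v).
  by move=> hv; rewrite /objective fineD ?ht_fin.
have := le_trans h1 ml; rewrite !oE ?dom_minimizer ?xt_dom //.
rewrite (ht_fine t hu) (ht_fine t dom_minimizer) gaptE // /Hr -/f -/X2.
have m0 := mu_gt0 t.
(* With a = u - x0 and X = xstar - x0:
   |X|^2 - |a|^2 - |a - X|^2 / 2 = 2/3 |X|^2 - |3 a - X|^2 / 6. *)
have : mu t * (X2 - dot (u - x0) (u - x0) - 2^-1 * dot (u - xstar) (u - xstar)) <=
   mu t * (2 / 3 * Dx).
  rewrite ler_pM2l //.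
  have := dot_ge0 (3 *: (u - x0) - (xstar - x0)).
  have -> : u - xstar = (u - x0) - (xstar - x0) by rewrite opprB addrA subrK.
  move: X2_le; rewrite /X2; move: (u - x0) (xstar - x0) => a b.
  rewrite !(dotBl, dotBr, dotZl, dotZr) (dotC b a); lra.
rewrite /Hr; lra.
Qed.

Lemma NoCK_expectation : (0 < T)%N -> DH / 2 ^+ T <= eps ->
  (expect (fun w : Om => objective F G h (NoCK_iter F G h x0 T w) - objective F G h xstar)
   <= eps%:E)%E.
Proof.
move=> T0 Teps; rewrite /expect.
rewrite (eq_bigr (fun w => (Hr (it T w) - Hr xstar)%:E)); last first.
  move=> w _; rewrite /objective -/(it T w).
  by rewrite -{1}(fineK (it_dom T w)) -{1}(fineK dom_minimizer).
rewrite sumEFin -EFinM lee_fin; apply: le_trans Teps.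
have [t TE] : exists t, T = t.+1 by exists T.-1; rewrite prednK.
have tT : (t < T)%N by rewrite TE.
apply: (@le_trans _ _ (avg (fun w => 2 * gapt t (it T w) + mu t / 3 * Dx))).
  by apply: (@avg_le R Om (fun w => Hr (it T w) - Hr xstar)) => w; exact: final_point.
rewrite avgD avgZ avg_cst // [_ / 3 * _]mulrAC muDx.
have := avg_step tT; rewrite -[in it t.+1]TE.
have := ler_wpM2l gam_ge0 (avg_bound (ltnW tT)).
have d0 : 0 <= DH / 2 ^+ t by rewrite divr_ge0 ?exprn_ge0 // ltW.
have := ler_wpM2r d0 gam_le.
(* x_T comes from round t = T - 1, and 2 (1/16) (4/3) + 1/3 = 1/2 exactly. *)
have -> : DH / 2 ^+ T = 2^-1 * (DH / 2 ^+ t) by rewrite TE exprS invfM mulrCA.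
move: (DH / _) d0 => d d0; lra.
Qed.

End NoCKAnalysis.

(** * Complexity *)

Lemma foldl_count (S I : Type) (f : S -> I -> S) (cnt : S -> nat) (k : I -> nat) s l :
  (forall s j, cnt (f s j) = (cnt s + k j)%N) ->
  cnt (foldl f s l) = (cnt s + \sum_(j <- l) k j)%N.
Proof.
move=> fk; elim: l s => [|j l IH] s; first by rewrite big_nil addn0.
by rewrite /= IH fk big_cons addnA.
Qed.

Section CallCount.
Context {R : realType} {n1 n2 N1 N2 : nat}.
Variables (F : 'I_n1 -> 'rV[R]_N1 -> R) (G : 'I_n2 -> 'rV[R]_N2 -> 'rV[R]_N1).
Variables (c : @constants R) (S : nat).

Definition step_cost (mu : R) : nat :=
  sizeA c mu + sizeA c mu + (sizeB c mu + sizeB c mu)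
  + (sizeC c mu + sizeC c mu) + 2.

Lemma SoCK_calls mu h x0 w :
  (@SoCK R n1 n2 N1 N2 F G c mu h S x0 w).2 =
  (S * (n2 + n2 + n1 + inner_len c mu * step_cost mu))%N.
Proof.
rewrite /SoCK; set fo := foldl _ _ _.
have -> : (let: (xt, st) := fo in (xt, calls st)).2 = calls fo.2 by case: fo.
rewrite /fo (foldl_count (cnt := fun xst => calls xst.2)
  (k := fun _ => (n2 + n2 + n1 + inner_len c mu * step_cost mu)%N)) /=.
  by rewrite add0n big_const_seq count_predT size_enum_ord iter_addn_0 mulnC.
case=> xt st s /=; rewrite /inner_state.
rewrite (foldl_count (cnt := @calls R N2) (k := fun _ => step_cost mu)).
  rewrite /= take_enum_ord_all big_const_seq count_predT size_enum_ord.
  by rewrite iter_addn_0 (mulnC (step_cost _)) !addnA.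
by move=> st' j; rewrite /SoCK_step; case: (w s j) => -[wA wB] wC.
Qed.

Lemma NoCK_complexityE h x0 mu0 T w :
  @NoCK_complexity R n1 n2 N1 N2 F G c h S x0 mu0 T w =
  (\sum_(t < T) S * (n2 + n2 + n1
     + inner_len c (NoCK_mu mu0 t) * step_cost (NoCK_mu mu0 t)))%N.
Proof.
rewrite /NoCK_complexity /NoCK_run take_enum_ord_all.
rewrite (foldl_count (cnt := snd) (k := fun t : 'I_T => (S * (n2 + n2 + n1
     + inner_len c (NoCK_mu mu0 t) * step_cost (NoCK_mu mu0 t)))%N)).
  by rewrite add0n big_enum.
case=> x k j; rewrite -(SoCK_calls (NoCK_h h x0 mu0 j) x (w j)).
by case: (SoCK _ _ _ _ _).
Qed.

End CallCount.

(** * Batch sizes, number of rounds and the sum of costs *)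

Section RealBounds.
Context {R : realType}.

Lemma powR_five_half (x : R) : 0 < x -> x `^ (5 / 2) = x ^+ 2 * Num.sqrt x.
Proof.
move=> x0; have -> : (5 / 2 : R) = 2%:R + 2^-1 by field.
by rewrite powRD ?(gt_eqF x0) ?implybT // powR_mulrn ?(ltW x0) // powR12_sqrt // ltW.
Qed.

Variables (L LF BF LG BG mu : R).
Hypotheses (mu_gt0 : 0 < mu) (mu_leL : mu <= L).
Let c := Constants L LF BF LG BG.
Let M := Num.max (Num.max (BG ^+ 4 * LF ^+ 2) (BF ^+ 2 * LG ^+ 2)) (L ^+ 2).

(** mu <= L gives M/mu^2 >= 1, which absorbs the rounding of the batch sizes and the two proximal
    calls: 2 (2161 + 2161 + 1081) + 2 = 10808, times 3/2 from the length of the inner loop. *)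
Lemma cost_bound : (inner_len c mu * step_cost c mu)%:R <=
  16212 * (M * (Num.sqrt (L / mu) * (mu^-1) ^+ 2)).
Proof.
have [MA MB MC] : [/\ BG ^+ 4 * LF ^+ 2 <= M, BF ^+ 2 * LG ^+ 2 <= M & L ^+ 2 <= M].
  by rewrite /M !le_max !lexx !orbT.
set i := mu^-1 ^+ 2; have i0 : 0 < i by rewrite exprn_gt0 // invr_gt0.
have iE : (mu ^+ 2)^-1 = i by rewrite /i exprVn.
have Mi : 1 <= M * i.
  rewrite -iE ler_pdivlMr ?exprn_gt0 // mul1r; apply: le_trans MC.
  by rewrite ler_pXn2r ?nnegrE ?(ltW mu_gt0) // (le_trans (ltW mu_gt0)).
have bat (a K K' : R) : 0 <= a -> 0 <= K * K' -> K * K' <= M ->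
    (pceil (a * K * K' / mu ^+ 2))%:R <= (a + 1) * (M * i).
  move=> a0 K0 KM; rewrite iE -[a * K * K']mulrA.
  apply: (@le_trans _ _ (a * (K * K') * i + 1)).
    by apply: pceil_le; apply: mulr_ge0; [exact: mulr_ge0|exact: ltW].
  by rewrite mulrDl mul1r lerD // -mulrA ler_wpM2l // ler_pM2r.
have e4 (x : R) : 0 <= x ^+ 4 by rewrite (exprM x 2 2) sqr_ge0.
have hA : (sizeA c mu)%:R <= (2160 + 1) * (M * i).
  by apply: (bat _ (BG ^+ 4) (LF ^+ 2)); rewrite ?ler0n // mulr_ge0 ?sqr_ge0.
have hB : (sizeB c mu)%:R <= (2160 + 1) * (M * i).
  by apply: (bat _ (BF ^+ 2) (LG ^+ 2)); rewrite ?ler0n // mulr_ge0 ?sqr_ge0.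
have hC : (sizeC c mu)%:R <= (1080 + 1) * (M * i).
  have := bat 1080 (L ^+ 2) 1; rewrite !mulr1; apply; rewrite ?ler0n ?sqr_ge0 //.
have hm : (inner_len c mu)%:R <= 3 / 2 * Num.sqrt (L / mu) by exact: inner_len_le.
have hs : (step_cost c mu)%:R <= 10808 * (M * i).
  rewrite /step_cost !natrD; move: hA hB hC Mi.
  move: (sizeA c mu)%:R (sizeB c mu)%:R (sizeC c mu)%:R (M * i) => a b d e; lra.
rewrite natrM; apply: (le_trans (ler_pM (ler0n _ _) (ler0n _ _) hm hs)).
by rewrite le_eqVlt; apply/orP; left; apply/eqP; field.
Qed.

End RealBounds.

Lemma step_cost_bound (R : realType) : exists2 k : R, 0 <= k &
  forall L LF BF LG BG mu : R, 0 < mu -> mu <= L ->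
  let c := Constants L LF BF LG BG in
  (inner_len c mu * step_cost c mu)%:R <=
  k * (Num.max (Num.max (BG ^+ 4 * LF ^+ 2) (BF ^+ 2 * LG ^+ 2)) (L ^+ 2)
       * (Num.sqrt (L / mu) * (mu^-1) ^+ 2)).
Proof. by exists 16212; [exact: ler0n|exact: cost_bound]. Qed.

Lemma sum_sqr_pow2_le (R : realType) (n : nat) :
  \sum_(t < n) ((2 : R) ^+ t) ^+ 2 <= (2 ^+ n) ^+ 2.
Proof.
elim: n => [|n IH]; first by rewrite big_ord0 sqr_ge0.
rewrite big_ord_recr /= (exprS 2 n) exprMn.
move: (sqr_ge0 ((2 : R) ^+ n)) IH.
by move: (_ ^+ n ^+ 2) (\sum_(_ < n) _) => u v; clear; lra.
Qed.

Section Complexity.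
Context {R : realType}.
Variables (DH Dx eps L : R).
Hypotheses (DH_gt0 : 0 < DH) (Dx_gt0 : 0 < Dx) (eps_gt0 : 0 < eps) (eps_lt : eps < DH).
Let mu0 := DH / Dx.
Let T := nceil (ln (DH / eps) / ln 2).

Let ln2_gt0 : 0 < ln 2 :> R. Proof. by rewrite ln_gt0 // ltr1n. Qed.

Let ratio_gt1 : 1 < DH / eps. Proof. by rewrite ltr_pdivlMr // mul1r. Qed.

Let l_gt0 : 0 < ln (DH / eps) / ln 2.
Proof. by rewrite divr_gt0 // ln_gt0. Qed.

Lemma rounds_gt0 : (0 < T)%N.
Proof. by rewrite -(ltr0n R); apply: lt_le_trans l_gt0 _; exact: nceil_ge. Qed.

Lemma rounds_le : T%:R <= ((ln 2)^-1 + 1) * Num.max 1 (ln (DH / eps)) :> R.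
Proof.
apply: (le_trans (nceil_le (ltW l_gt0))).
rewrite mulrDl mul1r lerD ?le_max ?lexx //.
by rewrite mulrC ler_pM2l ?invr_gt0 // le_max lexx orbT.
Qed.

Lemma rounds_accurate : DH / 2 ^+ T <= eps.
Proof.
have p2 : 0 < (2 : R) ^+ T by rewrite exprn_gt0.
rewrite ler_pdivrMr // mulrC -ler_pdivrMr //.
rewrite -ler_ln ?posrE ?divr_gt0 // lnXn // -[leRHS]mulr_natr -ler_pdivrMl // mulrC.
exact: nceil_ge.
Qed.

(** Rounding T up at most doubles 2^T, so mu never falls below eps/(2 Dx). *)
Lemma rounds_pow_le : 2 ^+ T <= 2 * (DH / eps).
Proof.
have p2 : 0 < (2 : R) ^+ T by rewrite exprn_gt0.
rewrite -ler_ln ?posrE ?mulr_gt0 ?invr_gt0 // lnXn // -[leLHS]mulr_natr lnM ?posrE ?divr_gt0 //.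
have := nceil_le (ltW l_gt0); rewrite -/T => /(ler_wpM2l (ltW ln2_gt0)).
by rewrite mulrDr mulr1 mulrCA mulfV ?gt_eqF // mulr1 addrC.
Qed.

(** The square root is bounded by a common value for all rounds, so that only powers of 4 are summed
    and no series of irrational ratio appears. The constant is 2 from sqrt(4Y) times 4 from
    (2Y)^2. *)
Lemma geometric_sum_le : 0 <= L ->
  \sum_(t < T) Num.sqrt (L / NoCK_mu mu0 t) * ((NoCK_mu mu0 t)^-1) ^+ 2 <=
  8 * (Dx `^ (5 / 2) * Num.sqrt L / eps `^ (5 / 2)).
Proof.
move=> L0; pose q := Dx / DH; pose Y := Dx / eps.
have q0 : 0 < q by exact: divr_gt0.
have Y0 : 0 < Y by exact: divr_gt0.
have muE t : (NoCK_mu mu0 t)^-1 = 2 ^+ t * q 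
  by rewrite /NoCK_mu /mu0 /q; field; rewrite !gt_eqF ?exprn_gt0.
have TY : 2 ^+ T * q <= 2 * Y.
  have := ler_wpM2r (ltW q0) rounds_pow_le; move/le_trans; apply.
  rewrite /q /Y le_eqVlt; apply/orP; left; apply/eqP; field.
  by rewrite !gt_eqF.
have sum4 := @sum_sqr_pow2_le R.
have sq t : (t < T)%N -> Num.sqrt (L / NoCK_mu mu0 t) <= 2 * (Num.sqrt L * Num.sqrt Y).
  move=> tT; rewrite muE.
  have -> : 2 * (Num.sqrt L * Num.sqrt Y) = Num.sqrt (L * (4 * Y)).
    have -> : L * (4 * Y) = 2 ^+ 2 * (L * Y) by ring.
    have sLY : Num.sqrt (L * Y) = Num.sqrt L * Num.sqrt Y by exact: sqrtrM.
    by rewrite (sqrtrM (L * Y) (sqr_ge0 2)) sLY sqrtr_sqr ger0_norm.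
  apply: ler_wsqrtr; rewrite ler_wpM2l //; apply: (@le_trans _ _ (2 ^+ T * q)).
    by rewrite ler_pM2r // ler_eXn2l ?ltr1n // ltnW.
  by apply: (le_trans TY); rewrite ler_pM2r // ler_nat.
apply: (@le_trans _ _ (\sum_(t < T) 2 * (Num.sqrt L * Num.sqrt Y) * ((2 ^+ t) ^+ 2 * q ^+ 2))).
  apply: ler_sum => t _; rewrite [in leLHS]muE -exprMn.
  by rewrite ler_wpM2r ?sqr_ge0 // -muE sq.
rewrite -mulr_sumr -mulr_suml.
have s0 : 0 <= Num.sqrt L * Num.sqrt Y by rewrite mulr_ge0 ?sqrtr_ge0.
apply: (@le_trans _ _ (2 * (Num.sqrt L * Num.sqrt Y) * (2 * Y) ^+ 2)).
  rewrite ler_wpM2l ?mulr_ge0 //; apply: (@le_trans _ _ ((2 ^+ T * q) ^+ 2)).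
    by rewrite (exprMn 2 (2 ^+ T) q) ler_wpM2r ?sqr_ge0.
  have a0 : 0 <= 2 ^+ T * q by apply: mulr_ge0; [exact: exprn_ge0|exact: ltW].
  by rewrite lerXn2r ?nnegrE // (le_trans a0).
rewrite !powR_five_half // /Y sqrtrM ?(ltW Dx_gt0) // sqrtrV ?(ltW eps_gt0) //.
rewrite le_eqVlt; apply/orP; left; apply/eqP; field.
by rewrite !gt_eqF // sqrtr_gt0.
Qed.

End Complexity.

(** Bernoulli gives (13/12)^12 >= 2. Since 96 = 12 * 8, the power is at most 1/256, and 12/256 <=
    1/16. *)
Lemma SoCK_rate_small (R : realType) (S : nat) : (96 <= S)%N ->
  12 * (12 / 13 : R) ^+ S <= 16^-1.
Proof.
move=> S96; pose r : R := 12 / 13.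
have r0 : 0 <= r by rewrite divr_ge0.
have r1 : r <= 1 by rewrite ler_pdivrMr // mul1r ler_nat.
have r12 : r ^+ 12 <= 2^-1.
  have -> : r = (1 + (12 * 1%:R)^-1)^-1 by rewrite /r; field.
  rewrite exprVn lef_pV2 ?posrE ?exprn_gt0 ?addr_gt0 ?invr_gt0 ?mulr_gt0 //.
  apply: le_trans (@theta_pow_ge R 1 12 isT).
  by rewrite mulr1 divff // pnatr_eq0.
have h1 : r ^+ S <= r ^+ (12 * 8) by exact: ler_wiXn2l.
have h2 : r ^+ (12 * 8) <= 2^-1 ^+ 8.
  by rewrite exprM; apply: lerXn2r; rewrite ?nnegrE ?exprn_ge0 ?invr_ge0.
have h3 : (2^-1 : R) ^+ 8 = 256^-1 by rewrite exprVn -natrX.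
rewrite h3 in h2; rewrite -/r; move: (le_trans h1 h2).
by move: (r ^+ S) => a; clear; lra.
Qed.

Lemma combine_bounds (R : realType) (a b x y k l : R) :
  a <= k * x -> b <= l * y -> 0 <= k * y -> 0 <= x -> 0 <= l * x -> 0 <= y ->
  a + b <= (k + l + 1) * (x + y).
Proof. lra. Qed.

Theorem theorem6p3 (R : realType) :
  exists S0 : nat, forall S : nat, (S0 <= S)%N ->
  exists K : R, 0 < K /\
  forall (n1 n2 N1 N2 : nat)
    (F : 'I_n1 -> 'rV[R]_N1 -> R) (G : 'I_n2 -> 'rV[R]_N2 -> 'rV[R]_N1)
    (h : 'rV[R]_N2 -> \bar R) (L LF BF LG BG : R)
    (xstar x0 : 'rV[R]_N2) (DH Dx eps : R),
  (0 < n1)%N -> (0 < n2)%N -> (0 < N1)%N -> (0 < N2)%N ->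
  (forall i u, differentiable (F i) u) ->
  (forall j x, differentiable (G j) x) ->
  proper_closed_convex h ->
  convex_function [set: 'rV[R]_N2] (fcomp F G) ->
  (forall i, smooth_fun LF (F i)) ->
  (forall i, bounded_grad BF (F i)) ->
  (forall j, smooth_map LG (G j)) ->
  (forall j, bounded_Jac BG (G j)) ->
  (forall i j x y,
     enorm (grad (F i) (Gavg G x) *m Jac (G j) x
            - grad (F i) (Gavg G y) *m Jac (G j) y) <= L * enorm (x - y)) ->
  (forall x, (objective F G h xstar <= objective F G h x)%E) ->
  (objective F G h x0 - objective F G h xstar <= DH%:E)%E ->
  enorm (x0 - xstar) ^+ 2 <= Dx ->
  0 < DH -> 0 < Dx -> 0 < eps -> eps < DH ->
  let c := Constants L LF BF LG BG in
  let mu0 := DH / Dx in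
  let T := nceil (ln (DH / eps) / ln 2) in
  mu0 <= L ->
  [/\ NoCK_requirement F G c h S x0 mu0 T,
      (expect (fun w : @NoCK_space R n1 n2 c S mu0 T =>
         objective F G h (NoCK_iter F G h x0 T w) - objective F G h xstar)
       <= eps%:E)%E
    & forall w : @NoCK_space R n1 n2 c S mu0 T,
      (NoCK_complexity F G h x0 w)%:R
      <= K * ((n1 + n2)%:R * Num.max 1 (ln (DH / eps))
              + Dx `^ (5 / 2) * Num.sqrt L
                * Num.max (Num.max (BG ^+ 4 * LF ^+ 2) (BF ^+ 2 * LG ^+ 2))
                          (L ^+ 2)
                / eps `^ (5 / 2))].
Proof.
exists 96%N => S S96; have rate := SoCK_rate_small R S96.
have ln2_gt0 : 0 < ln 2 :> R by rewrite ln_gt0 // ltr1n.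
have [k k_ge0 cost] := step_cost_bound R.
(* [K1] pays for snapshots: at most 2 (n1 + n2) evaluations per outer loop, over all rounds. [K2]
   pays for inner loops, with 8 from the geometric sum. Both depend on S alone among the parameters
   of the method. *)
pose K1 : R := S%:R * (2 * ((ln 2)^-1 + 1)); pose K2 : R := S%:R * (k * 8).
have K1_ge0 : 0 <= K1 by rewrite !mulr_ge0 ?ler0n // addr_ge0 // invr_ge0 ltW.
have K2_ge0 : 0 <= K2 by rewrite mulr_ge0 ?ler0n // mulr_ge0.
exists (K1 + K2 + 1); split; first by rewrite ltr_wpDl // addr_ge0.
move=> n1 n2 N1 N2 F G h L LF BF LG BG xstar x0 DH Dx eps n1_gt0 n2_gt0 N1_gt0 N2_gt0
  dF dG pcc convf smF bF smG bG lipFG xstar_min DH_bound Dx_bound DH_gt0 Dx_gt0 eps_gt0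
  eps_lt c mu0 T mu0_leL.
have hN x : h x != -oo%E by case: pcc => -[].
have sdom : h xstar \is a fin_num := dom_minimizer pcc xstar_min.
(* Finiteness of h at the starting point is implied by the bound [DH] read in the extended reals. *)
have x0dom : h x0 \is a fin_num.
  rewrite fin_numE hN /=; apply/negP => /eqP hx.
  by move: DH_bound; rewrite /objective hx addey // -(fineK sdom) -EFinD -EFinN addye // leye_eq.
have gap0 : fcomp F G x0 + fine (h x0) - (fcomp F G xstar + fine (h xstar)) <= DH.
  have E : (objective F G h x0 - objective F G h xstar =
      (fcomp F G x0 + fine (h x0) - (fcomp F G xstar + fine (h xstar)))%:E)%E.
    by rewrite /objective -{1}(fineK x0dom) -{1}(fineK sdom).
  by move: DH_bound; rewrite E lee_fin.
split.
- exact: (NoCK_requirementP n1_gt0 n2_gt0 N1_gt0 N2_gt0 dF dG pcc convf smF bF smG bG lipFG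
    xstar_min DH_gt0 Dx_gt0 mu0_leL rate x0dom).
- apply: (NoCK_expectation n1_gt0 n2_gt0 N1_gt0 N2_gt0 dF dG pcc convf smF bF smG bG lipFG
    xstar_min Dx_bound DH_gt0 Dx_gt0 mu0_leL rate x0dom gap0).
  + exact: rounds_gt0.
  + exact: rounds_accurate.
move=> w; rewrite NoCK_complexityE natr_sum.
have mu0_gt0 : 0 < mu0 by exact: divr_gt0.
have mu_gt0 t : 0 < NoCK_mu mu0 t by rewrite divr_gt0 // exprn_gt0.
have mu_leL t : NoCK_mu mu0 t <= L.
  apply: le_trans mu0_leL; rewrite ler_pdivrMr ?exprn_gt0 //.
  by rewrite ler_peMr ?(ltW mu0_gt0) // exprn_ege1 // ler1n.
have L0 : 0 <= L by apply: le_trans mu0_leL; exact: ltW.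
set M := Num.max _ (L ^+ 2).
have M0 : 0 <= M by rewrite le_max sqr_ge0 orbT.
set mx := Num.max 1 _; set P := Dx `^ _; set E := eps `^ _.
have geo := geometric_sum_le DH_gt0 Dx_gt0 eps_gt0 eps_lt L0.
have rT := rounds_le eps_gt0 eps_lt.
apply: (@le_trans _ _ (\sum_(t < T) S%:R * (2 * (n1 + n2)%:R
   + k * M * (Num.sqrt (L / NoCK_mu mu0 t) * ((NoCK_mu mu0 t)^-1) ^+ 2)))).
  apply: ler_sum => t _; rewrite natrM ler_wpM2l ?ler0n // natrD lerD //.
    by rewrite !natrD; move: (ler0n R n1); move: n1%:R n2%:R => a b; clear; lra.
  by rewrite -mulrA; exact: cost.
rewrite -mulr_sumr big_split /= sumr_const card_ord -[(2 * _) *+ T]mulr_natr -mulr_sumr mulrDr.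
have Q0 : 0 <= P * Num.sqrt L * M / E.
  by rewrite !mulr_ge0 ?powR_ge0 ?sqrtr_ge0 ?invr_ge0 ?powR_ge0.
have mx1 : 1 <= mx by rewrite le_max lexx.
have h1 : S%:R * (2 * (n1 + n2)%:R * T%:R) <= K1 * ((n1 + n2)%:R * mx).
  rewrite /K1 -!mulrA ler_wpM2l ?ler0n // ler_pM2l // mulrCA ler_wpM2l ?ler0n //.
have h2 : S%:R * (k * M * \sum_(t < T) (Num.sqrt (L / NoCK_mu mu0 t) * ((NoCK_mu mu0 t)^-1) ^+ 2))
   <= K2 * (P * Num.sqrt L * M / E).
  have -> : K2 * (P * Num.sqrt L * M / E) = S%:R * (k * M * (8 * (P * Num.sqrt L / E))).
    by rewrite /K2; ring.
  by rewrite ler_wpM2l ?ler0n // ler_wpM2l // mulr_ge0.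
have h3 := mulr_ge0 K1_ge0 Q0.
have h4 : 0 <= (n1 + n2)%:R * mx by rewrite mulr_ge0 ?ler0n // (le_trans ler01).
have h5 := mulr_ge0 K2_ge0 h4.
exact: (combine_bounds h1 h2 h3 h4 h5 Q0).
Qed.
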